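(* Let $\varphi=(1+\sqrt5)/2$, and let $\tau$ be the infimum of $\rho(I)$ over all instances $I$ (planar disk pan and finite inventory) on which some descending greedy execution fails to place the lex-max set. Then $\tau=\varphi$, and the infimum is not attained. This holds both for the class of instances with common positive width and for the class of instances with independent positive widths (equivalently, independent hole radii $0\le h_i<r_i$).
   Context: Model. The pan is a closed disk of radius $R$ in the plane. An inventory is a finite list of outer radii $r_1>r_2>\dots>r_n>0$, ring $i$ having a hole that is a disk of radius $h_i$. With common width $w>0$, $h_i=\max(0,r_i-w)$; with independent holes, the $h_i$ are arbitrary with $0\le h_i<r_i$. A placement of a set $S$ of rings is a forest: each ring of $S$ has as parent either the pan or another ring of $S$ (whose hole radius is at least the child's outer radius), and the children of each common parent must be packable in the parent's region (the pan, or the hole disk of radius $h_i$ of ring $i$), i.e. closed disks having the children's outer radii can be positioned inside that region with pairwise disjoint interiors. Feasibility depends only on the parent assignment. $S$ is feasible if it has a placement. The lex-max set $L$ is defined by scanning $i=1,\dots,n$ and including $i$ whenever $(L\cap\{1,\dots,i-1\})\cup\{i\}$ is feasible. A descending greedy execution processes the rings in decreasing outer radius; when ring $i$ is processed, a container (the pan or the hole of an already placed ring) admits it if the container's current children together with ring $i$ are packable in it (sibling positions may be rearranged); the ring receives some admitting container as its permanent parent, chosen arbitrarily, and is skipped only if no container admits it. An execution fails if it does not place exactly $L$. $\rho=\max_i\bigl(\sum_{j>i}r_j\bigr)/r_i$. *)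

(* Defs.v *)
From HB Require Import structures.
From mathcomp Require Import all_boot all_order all_algebra.
From mathcomp Require Import all_classical all_reals all_analysis.

Set Implicit Arguments.
Unset Strict Implicit.
Unset Printing Implicit Defensive.

Import Order.TTheory GRing.Theory Num.Theory.
Import numFieldNormedType.Exports.

Local Open Scope classical_set_scope.
Local Open Scope ring_scope.

Definition golden (R : realType) : R := (1 + Num.sqrt 5) / 2.

(* The norm that the library puts on R * R is the sup norm, hence the explicit
   Euclidean distance; the topology, and so [interior], is the same. *)
Definition edist (R : realType) (p q : R * R) : R :=
  Num.sqrt ((p.1 - q.1) ^+ 2 + (p.2 - q.2) ^+ 2).

Definition disk (R : realType) (c : R * R) (r : R) : set (R * R) :=
  [set p | edist p c <= r].

Definition packable (R : realType) (T : finType) (rad : T -> R) (A : {set T})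
    (H : R) : Prop :=
  exists c : T -> R * R,
    (forall i, i \in A -> disk (c i) (rad i) `<=` disk (0, 0) H) /\
    (forall i j, i \in A -> j \in A -> i != j ->
       interior (disk (c i) (rad i)) `&` interior (disk (c j) (rad j)) = set0).

(* Rings are indexed from 0 in order of decreasing outer radius.  The bounds
   on [hole] are those of independent positive widths. *)
Record instance (R : realType) := Instance {
  nrings : nat;
  pan_radius : R;
  outer : 'I_nrings -> R;
  hole : 'I_nrings -> R;
  pan_gt0 : 0 < pan_radius;
  outer_gt0 : forall i, 0 < outer i;
  outer_decr : forall i j : 'I_nrings, (i < j)%N -> outer j < outer i;
  hole_ge0 : forall i, 0 <= hole i;
  hole_lt_outer : forall i, hole i < outer i
}.

Arguments outer {R} I i : rename.
Arguments hole {R} I i : rename.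

Definition common_width (R : realType) : set (instance R) :=
  [set I | exists2 w : R, 0 < w &
     forall i, hole I i = Num.max 0 (outer I i - w)].

Definition independent_widths (R : realType) : set (instance R) := setT.

Section Model.
Variables (R : realType) (I : instance R).

Local Notation ring := 'I_(nrings I).

(* [None] is the pan, [Some j] is the hole of ring [j]. *)
Definition container := option ring.

Definition region_radius (c : container) : R :=
  if c is Some j then hole I j else pan_radius I.

(* Only the values of [parent] on [S] matter.  No acyclicity condition is
   needed for a forest: [outer I i <= hole I j < outer I j] makes the radius
   strictly increase from a ring to its parent. *)
Definition placement (S : {set ring}) (parent : ring -> container) : Prop :=
  (forall i j, i \in S -> parent i = Some j ->
     j \in S /\ outer I i <= hole I j) /\
  (forall c, packable (outer I) [set i in S | parent i == c]%SET (region_radius c)).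

Definition feasible (S : {set ring}) : Prop := exists parent, placement S parent.

(* [enum 'I_n] lists the indices in increasing order. *)
Definition lexmax : {set ring} :=
  foldl (fun L i => if `[< feasible (i |: L) >] then i |: L else L)
        finset.set0 (enum ring).

(* A run of the greedy procedure is recorded by its decisions: [e i = None] if
   ring [i] is skipped, [e i = Some c] if it is put in container [c].  As
   decisions are permanent, the state reached when ring [i] is processed is
   the restriction of [e] to the indices [j < i]. *)
Definition decisions := ring -> option container.

Definition available (e : decisions) (i : ring) (c : container) : Prop :=
  if c is Some j then (j < i)%N /\ e j <> None else True.

Definition children_before (e : decisions) (i : ring) (c : container) :
    {set ring} :=
  [set j : ring | (j < i)%N && (e j == Some c)]%SET.

Definition admits (e : decisions) (i : ring) (c : container) : Prop :=
  available e i c /\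
  packable (outer I) (i |: children_before e i c) (region_radius c).

Definition greedy_execution (e : decisions) : Prop :=
  forall i, if e i is Some c then admits e i c else forall c, ~ admits e i c.

Definition placed (e : decisions) : {set ring} := [set i | e i != None]%SET.

Definition greedy_can_fail : Prop :=
  exists2 e, greedy_execution e & placed e <> lexmax.

(* All the ratios are nonnegative, so the base value 0 only matters for the
   empty inventory. *)
Definition rho : R :=
  \big[Num.max/0]_(i < nrings I)
    ((\sum_(j < nrings I | (i < j)%N) outer I j) / outer I i).

End Model.

Definition failing_rhos (R : realType) (C : set (instance R)) : set R :=
  [set rho I | I in C `&` [set I | greedy_can_fail I]].

(* [inf] is 0 on the empty set, so a nonzero value of [tau] entails that
   failing instances exist. *)
Definition tau (R : realType) (C : set (instance R)) : R := inf (failing_rhos C).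

(* Main.v *)
From mathcomp Require Import all_boot all_order all_algebra.
From mathcomp Require Import all_classical all_reals all_analysis.
From mathcomp Require Import ring lra.
(* Imported last, so that [edist] is the Euclidean distance in the plane. *)
Require Import Defs.

(** A run that misses the lex-max set first goes wrong at a ring [n]: the rings
    placed before it are those of the lex-max set, some placement [p] holds
    them together with [n], and yet no container of the run admits [n].  This
    cannot happen when [rho I <= golden R], which gives the lower bound and
    shows that it is not attained.

    The heart of the matter is one container, with children of which [u] is
    the largest and [v] the second largest ([pack_last]): if yet another ring
    [k] lies strictly between [v] and [n] in size, then [n] can be added.
    Scale [u] to radius 1, and let [b] be the radius of [v]; the container has
    radius at least [1 + b].  Let [D] be the total radius of the rings smaller
    than [v].  The tails of [v] and of [u] give [D <= golden R * b] and
    [b + D <= golden R].  In a disk of radius [1 + b] the disks of radii 1 and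
    [b] leave two pockets, each for a disk of radius
    [x = b * (1 + b) / (1 + b + b ^+ 2)].  The golden ratio is the number for
    which both bounds on [D] equal [2 * x] at a common [b], its inverse, so
    that [D <= 2 * x] for all [b] ([golden_pockets]).  In particular [n], being
    smaller than half of [D], fits into a pocket.  If further children are
    present, let [c] be the radius of the largest of them.  When [c <= x], the
    small disks can be spread in rows over the two pockets and a third one,
    the next disk in the Pappus chain ([packs_pappus]).  When [c > x], a
    container that holds 1, [b] and [c] holds their outer Soddy circle
    ([soddy_outer_le]), and there the pocket facing [c] has radius at least
    [2 * x - c] ([soddy_pocket_ge]), enough for a row of all the others.

    So if no container admits [n], two siblings of the run always include the
    last ring placed, and the other rings form a single chain of nested rings.
    Comparing [p] with the run ring by ring then shows that they agree on all
    the placed rings ([placement_extends]); but then the container that [p]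
    gives to [n] admits it in the run.

    The bound is sharp because of the rings of radii 1, [(golden R)^-1],
    [1 / 2 + 2 * e] and [1 / 2 + e] with width [1 / 5] in a pan of radius
    [golden R] ([trap]).  A run may put the second ring beside the first
    instead of inside it.  The third ring then has to take the hole of the
    first, and the last one fits nowhere, since the pocket that remains in the
    pan has radius exactly [1 / 2].  As [e] tends to 0, [rho] tends to the
    golden ratio. *)

Set Implicit Arguments.
Unset Strict Implicit.
Unset Printing Implicit Defensive.

Import Order.TTheory GRing.Theory Num.Theory.
Import numFieldNormedType.Exports.

Local Open Scope classical_set_scope.
Local Open Scope ring_scope.

(** * Distances and disks in the plane *)

Lemma sqr_edist (R : realType) (p q : R * R) :
  edist p q ^+ 2 = (p.1 - q.1) ^+ 2 + (p.2 - q.2) ^+ 2.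
Proof. by rewrite sqr_sqrtr // addr_ge0 // sqr_ge0. Qed.

Lemma edist_ge0 (R : realType) (p q : R * R) : 0 <= edist p q.
Proof. exact: sqrtr_ge0. Qed.

Lemma edistC (R : realType) (p q : R * R) : edist p q = edist q p.
Proof. by congr Num.sqrt; ring. Qed.

Lemma edistxx (R : realType) (p : R * R) : edist p p = 0.
Proof. by rewrite /edist !subrr expr0n /= addr0 sqrtr0. Qed.

Lemma edist_le (R : realType) (p q : R * R) (d : R) : 0 <= d ->
  (edist p q <= d) = ((p.1 - q.1) ^+ 2 + (p.2 - q.2) ^+ 2 <= d ^+ 2).
Proof. by move=> d0; rewrite -sqr_edist ler_sqr // nnegrE edist_ge0. Qed.

Lemma edist_lt (R : realType) (p q : R * R) (d : R) : 0 <= d ->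
  (edist p q < d) = ((p.1 - q.1) ^+ 2 + (p.2 - q.2) ^+ 2 < d ^+ 2).
Proof. by move=> d0; rewrite -sqr_edist ltr_sqr // nnegrE edist_ge0. Qed.

Lemma le_edist (R : realType) (p q : R * R) (d : R) : 0 <= d ->
  (d <= edist p q) = (d ^+ 2 <= (p.1 - q.1) ^+ 2 + (p.2 - q.2) ^+ 2).
Proof. by move=> d0; rewrite -sqr_edist ler_sqr // nnegrE edist_ge0. Qed.

Lemma edist_triangle (R : realType) (p q r : R * R) :
  edist p r <= edist p q + edist q r.
Proof.
rewrite edist_le ?addr_ge0 ?edist_ge0 //.
have := sqr_edist p q; have := sqr_edist q r.
have := edist_ge0 p q; have := edist_ge0 q r.
move: (edist p q) (edist q r) => s t t0 s0 tE sE.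
case: p q r sE tE => [p1 p2] [q1 q2] [r1 r2] /= sE tE.
set x := p1 - q1 in sE; set y := p2 - q2 in sE.
set z := q1 - r1 in tE; set w := q2 - r2 in tE.
have -> : p1 - r1 = x + z by rewrite /x /z; ring.
have -> : p2 - r2 = y + w by rewrite /y /w; ring.
suff h : x * z + y * w <= s * t.
  have -> : (s + t) ^+ 2 = s ^+ 2 + t ^+ 2 + 2 * (s * t) by ring.
  by rewrite sE tE; lra.
apply: le_trans (ler_norm _) _.
rewrite -ler_sqr ?nnegrE ?normr_ge0 ?mulr_ge0 // real_normK ?num_real //.
rewrite exprMn sE tE -subr_ge0.
have -> : (x ^+ 2 + y ^+ 2) * (z ^+ 2 + w ^+ 2) - (x * z + y * w) ^+ 2 =
  (x * w - y * z) ^+ 2 by ring.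
exact: sqr_ge0.
Qed.

(** The point of the small disk farthest from the origin lies on the ray
    through its center. *)
Lemma disk_subset (R : realType) (c : R * R) (r H : R) : 0 <= r ->
  disk c r `<=` disk (0, 0) H <-> edist c (0, 0) + r <= H.
Proof.
move=> r0; split=> [sub|le p]; last first.
  rewrite /disk /= => pc; apply: le_trans (edist_triangle _ c _) _.
  by lra.
have [d0|dn0] := eqVneq (edist c (0, 0)) 0.
  have c0 : c = (0, 0).
    move: (sqr_edist c (0, 0)); rewrite d0 expr0n /= !subr0.
    move/esym/eqP; rewrite paddr_eq0 ?sqr_ge0 // !sqrf_eq0.
    by case: c {sub d0} => [c1 c2] /= /andP[/eqP -> /eqP ->].
  have /sub /= : disk c r (r, 0).
    by rewrite c0 /disk /= edist_le //= !subr0 expr0n /= addr0.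
  rewrite d0 add0r; apply: le_trans.
  by rewrite le_edist //= !subr0 expr0n /= addr0.
have d0 : 0 < edist c (0, 0) by rewrite lt_def dn0 edist_ge0.
have := sqr_edist c (0, 0); rewrite /= !subr0 => dE.
set d := edist c (0, 0) in d0 dn0 dE *.
pose k := 1 + r / d.
have /sub : disk c r (k * c.1, k * c.2).
  rewrite /disk /= edist_le //=.
  have -> : (k * c.1 - c.1) ^+ 2 + (k * c.2 - c.2) ^+ 2 =
    (r / d) ^+ 2 * (c.1 ^+ 2 + c.2 ^+ 2) by rewrite /k; ring.
  by rewrite -dE -exprMn divfK.
apply: le_trans; rewrite le_edist /= ?subr0; last by rewrite addr_ge0 // ltW.
have -> : (k * c.1) ^+ 2 + (k * c.2) ^+ 2 = k ^+ 2 * (c.1 ^+ 2 + c.2 ^+ 2).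
  by ring.
rewrite -dE -exprMn /k mulrDl mul1r divfK //.
Qed.

(** Moving from an interior point away from the center stays in the disk for a
    short while, so the point is not on the boundary circle. *)
Lemma interior_disk_lt (R : realType) (c p : R * R) (r : R) : 0 < r ->
  interior (disk c r) p -> edist p c < r.
Proof.
move=> r0 int; rewrite lt_neqAle; apply/andP; split; last first.
  exact: (interior_subset int).
apply/eqP => pr.
move: int => /nbhs_ballP[e /= e0 he].
set x := p.1 - c.1; set y := p.2 - c.2.
pose t := e / (1 + `|x| + `|y|).
have x0 := normr_ge0 x; have y0 := normr_ge0 y.
have n0 : 0 < 1 + `|x| + `|y| by lra.
have t0 : 0 < t by rewrite divr_gt0.
have tE : e = t * (1 + `|x| + `|y|) by rewrite /t divfK // lt0r_neq0.
have : disk c r (p.1 + t * x, p.2 + t * y).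
  apply: he; split; rewrite /ball /= opprD addNKr normrN normrM gtr0_norm // tE.
    by rewrite ltr_pM2l //; lra.
  by rewrite ltr_pM2l //; lra.
rewrite /disk /= edist_le ?(ltW r0) //= => h.
have := sqr_edist p c; rewrite pr -/x -/y => rE.
have {}h : (1 + t) ^+ 2 * r ^+ 2 <= r ^+ 2.
  apply: le_trans h; rewrite rE le_eqVlt; apply/orP; left; apply/eqP.
  by rewrite /x /y; ring.
have : 1 < (1 + t) ^+ 2 by nra.
have : 0 < r ^+ 2 by rewrite exprn_gt0.
nra.
Qed.

Lemma lt_interior_disk (R : realType) (c p : R * R) (r : R) : 0 < r ->
  edist p c < r -> interior (disk c r) p.
Proof.
move=> r0 pr; rewrite /interior /=.
pose d := r - edist p c.
have d0 : 0 < d by rewrite subr_gt0.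
apply/nbhs_ballP; exists (d / 2); first by rewrite /= divr_gt0.
move=> q [/= q1 q2]; rewrite /disk /=.
apply: le_trans (edist_triangle _ p _) _.
suff : edist q p <= d by rewrite /d; lra.
rewrite edist_le ?(ltW d0) //.
have e1 : (q.1 - p.1) ^+ 2 <= (d / 2) ^+ 2.
  rewrite -[X in X <= _]real_normK ?num_real // ler_sqr ?nnegrE ?normr_ge0 //.
    by rewrite distrC ltW.
  by rewrite divr_ge0 // ltW.
have e2 : (q.2 - p.2) ^+ 2 <= (d / 2) ^+ 2.
  rewrite -[X in X <= _]real_normK ?num_real // ler_sqr ?nnegrE ?normr_ge0 //.
    by rewrite distrC ltW.
  by rewrite divr_ge0 // ltW.
nra.
Qed.

Lemma interior_disks_disjoint (R : realType) (c c' : R * R) (r r' : R) :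
  0 < r -> 0 < r' ->
  interior (disk c r) `&` interior (disk c' r') = set0 <->
  r + r' <= edist c c'.
Proof.
move=> r0 r'0; split=> [dis|le].
  rewrite leNgt; apply/negP => lt.
  have rr0 : 0 < r + r' by rewrite addr_gt0.
  (* The point dividing the segment between the centers in the ratio of the
     radii is interior to both disks. *)
  pose k := r / (r + r'); pose k' := r' / (r + r').
  have kk' : k + k' = 1 by rewrite /k /k' -mulrDl divff // lt0r_neq0.
  have k0 : 0 < k by rewrite divr_gt0.
  have k'0 : 0 < k' by rewrite divr_gt0.
  have kE : r = k * (r + r') by rewrite /k divfK // lt0r_neq0.
  have k'E : r' = k' * (r + r') by rewrite /k' divfK // lt0r_neq0.
  clearbody k k'.
  pose m : R * R := (k' * c.1 + k * c'.1, k' * c.2 + k * c'.2).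
  move: (lt); rewrite edist_lt ?ltW // => lt2.
  have mc : edist m c < r.
    rewrite edist_lt ?ltW // kE exprMn.
    have -> : m.1 - c.1 = k * (c'.1 - c.1).
      by rewrite /m /=; have -> : k' = 1 - k; [rewrite -kk'; ring|ring].
    have -> : m.2 - c.2 = k * (c'.2 - c.2).
      by rewrite /m /=; have -> : k' = 1 - k; [rewrite -kk'; ring|ring].
    rewrite !exprMn -mulrDr ltr_pM2l ?exprn_gt0 //.
    by rewrite -(sqrrN (c'.1 - c.1)) -(sqrrN (c'.2 - c.2)) !opprB.
  have mc' : edist m c' < r'.
    rewrite edist_lt ?ltW // k'E exprMn.
    have -> : m.1 - c'.1 = k' * (c.1 - c'.1).
      by rewrite /m /=; have -> : k = 1 - k'; [rewrite -kk'; ring|ring].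
    have -> : m.2 - c'.2 = k' * (c.2 - c'.2).
      by rewrite /m /=; have -> : k = 1 - k'; [rewrite -kk'; ring|ring].
    by rewrite !exprMn -mulrDr ltr_pM2l ?exprn_gt0.
  suff : (interior (disk c r) `&` interior (disk c' r')) m by rewrite dis.
  by split; apply: lt_interior_disk.
rewrite -subset0 => p [/(interior_disk_lt r0) pc /(interior_disk_lt r'0) pc'].
have := edist_triangle c p c'; rewrite (edistC c p).
lra.
Qed.

(** A packing stated by distances alone: for positive radii this is
    [packable] ([packableP]), freed from disks as sets and from topology. *)
Definition packs (R : realType) (T : finType) (rad : T -> R) (A : {set T})
    (H : R) : Prop :=
  exists c : T -> R * R,
    (forall i, i \in A -> edist (c i) (0, 0) + rad i <= H) /\
    (forall i j, i \in A -> j \in A -> i != j ->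
       rad i + rad j <= edist (c i) (c j)).

Lemma packableP (R : realType) (T : finType) (rad : T -> R) (A : {set T})
    (H : R) : (forall i, 0 < rad i) -> packable rad A H <-> packs rad A H.
Proof.
move=> r0; split=> -[c [c1 c2]]; exists c; split=> [i iA|i j iA jA ij].
- by apply/disk_subset; [exact: ltW|exact: c1].
- by apply/interior_disks_disjoint => //; exact: c2.
- by apply/disk_subset; [exact: ltW|exact: c1].
- by apply/interior_disks_disjoint => //; exact: c2.
Qed.

Lemma packs_sub (R : realType) (T : finType) (rad : T -> R) (A B : {set T})
    (H : R) : A \subset B -> packs rad B H -> packs rad A H.
Proof.
move=> /fintype.subsetP AB [c [c1 c2]]; exists c; split=> [i /AB|i j /AB + /AB].
  exact: c1.
exact: c2.
Qed.

Lemma packs_scale (R : realType) (T : finType) (rad : T -> R) (A : {set T})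
    (H k : R) : 0 < k ->
  packs rad A H -> packs (fun i => k * rad i) A (k * H).
Proof.
move=> k0 [c [c1 c2]].
have dE p q : edist (k * p.1, k * p.2) (k * q.1, k * q.2) = k * edist p q.
  rewrite -[k in RHS]ger0_norm ?ltW // -sqrtr_sqr -sqrtrM ?sqr_ge0 //.
  by congr Num.sqrt => /=; ring.
exists (fun i => (k * (c i).1, k * (c i).2)); split=> [i iA|i j iA jA ij].
  have := dE (c i) (0, 0); rewrite /= mulr0 => ->.
  by rewrite -mulrDr ler_pM2l // c1.
by rewrite dE -mulrDr ler_pM2l // c2.
Qed.

Lemma packs_le (R : realType) (T : finType) (rad : T -> R) (A : {set T})
    (H : R) i : i \in A -> packs rad A H -> rad i <= H.
Proof.
move=> iA [c [/(_ i iA) c1 _]]; apply: le_trans c1.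
by rewrite lerDr edist_ge0.
Qed.

Lemma packs_le2 (R : realType) (T : finType) (rad : T -> R) (A : {set T})
    (H : R) i j : i \in A -> j \in A -> i != j -> packs rad A H ->
  rad i + rad j <= H.
Proof.
move=> iA jA ij [c [c1 c2]].
have := c1 i iA; have := c1 j jA; have := c2 i j iA jA ij.
have := edist_triangle (c i) (0, 0) (c j); rewrite (edistC (0, 0)).
lra.
Qed.

(** Each disk of a packing can be exchanged for a row of disks along its
    horizontal diameter.  This reduces every packing construction below to a
    few slots and a bound on sums of radii: an entry of [l] is a set of disks
    with the center and the radius of their slot. *)
Lemma packs_rows (R : realType) (T : finType) (rad : T -> R) (A : {set T})
    (H : R) (l : seq ({set T} * (R * R) * R)) :
  (forall i, 0 < rad i) ->
  (forall i, i \in A -> has (fun t : {set T} * (R * R) * R => i \in t.1.1) l) ->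
  all (fun t : {set T} * (R * R) * R => (\sum_(i in t.1.1) rad i <= t.2) &&
                (edist t.1.2 (0, 0) + t.2 <= H)) l ->
  pairwise (fun t t' : {set T} * (R * R) * R =>
              t.2 + t'.2 <= edist t.1.2 t'.1.2) l ->
  packs rad A H.
Proof.
move=> r0 cov /allP fit sep.
pose g i := find (fun t : {set T} * (R * R) * R => i \in t.1.1) l.
pose slot k := nth (finset.set0, (0, 0), 0) l k.
pose U i := (slot (g i)).1.1; pose z i := (slot (g i)).1.2.
pose s i := (slot (g i)).2.
pose off i := \sum_(j in U i | (enum_rank j < enum_rank i)%N) rad j.
pose c i : R * R := ((z i).1 - s i + 2 * off i + rad i, (z i).2).
have gA i : i \in A -> (g i < size l)%N by move=> /cov; rewrite has_find.
have UA i : i \in A -> i \in U i.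
  by move=> /cov /(nth_find (finset.set0, (0, 0), 0)).
have off0 i : 0 <= off i by apply: sumr_ge0 => j _; exact: ltW.
(* [c i] puts the disks of a slot side by side from its left end, in the
   order of [enum_rank]; [off i] is half the width taken before [i]. *)
have offs i : i \in A -> off i + rad i <= s i.
  move=> iA.
  have /andP[+ _] := fit _ (mem_nth (finset.set0, (0, 0), 0) (gA _ iA)).
  apply: le_trans; rewrite [leRHS](bigD1 i) ?UA //= [leLHS]addrC lerD2l.
  rewrite [leRHS](bigID (fun j => enum_rank j < enum_rank i)%N) /=.
  rewrite -[leLHS]addr0 lerD ?sumr_ge0 // => [|j _]; last exact: ltW.
  rewrite le_eqVlt; apply/orP; left; apply/eqP; apply: eq_bigl => j.
  rewrite -andbA; congr andb; case: eqVneq => [->|//=]; by rewrite ltnn.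
have cz i : i \in A -> edist (c i) (z i) <= s i - rad i.
  move=> iA; have oi := offs i iA; have oi0 := off0 i; have ri0 := r0 i.
  rewrite edist_le; last by lra.
  rewrite /c /= subrr expr0n addr0.
  move: (off i) (s i) (rad i) oi oi0 ri0 => o si ri oi oi0 ri0.
  have -> : (z i).1 - si + 2 * o + ri - (z i).1 = 2 * o + ri - si by ring.
  by nra.
have same i j : i \in A -> j \in A -> g i = g j ->
    (enum_rank i < enum_rank j)%N -> rad i + rad j <= edist (c i) (c j).
  move=> iA jA gij ij.
  have oij : off i + rad i <= off j.
    rewrite /off /U -gij [leRHS](bigD1 i) /=; last by rewrite ij UA.
    rewrite [leLHS]addrC lerD2l.
    rewrite [leRHS](bigID (fun k => enum_rank k < enum_rank i)%N) /=.
    rewrite -[leLHS]addr0 lerD ?sumr_ge0 // => [|k _]; last exact: ltW.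
    rewrite le_eqVlt; apply/orP; left; apply/eqP; apply: eq_bigl => k.
    rewrite -!andbA; congr andb; case: (ltnP (enum_rank k) (enum_rank i)).
      move=> ki; rewrite (ltn_trans ki ij) /=; case: eqVneq ki => // ->.
      by rewrite ltnn.
    by rewrite !andbF.
  rewrite le_edist; last by have := r0 i; have := r0 j; lra.
  rewrite /c /= /z /s gij subrr expr0n /= addr0.
  have := r0 i; have := r0 j; have := off0 i.
  move: (off i) (off j) (rad i) (rad j) oij => oi oj ri rj h1 h2 h3 h4.
  set a := (X in _ <= X ^+ 2).
  have -> : a = - (2 * (oj - oi) + rj - ri) by rewrite /a; ring.
  rewrite sqrrN; nra.
exists c; split=> [i iA|i j iA jA ij].
  have /andP[_] := fit _ (mem_nth (finset.set0, (0, 0), 0) (gA _ iA)).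
  have := cz i iA; have := edist_triangle (c i) (z i) (0, 0).
  rewrite /z /s /slot; lra.
have [gij|gij] := eqVneq (g i) (g j).
  have [lt|gt|/ord_inj/enum_rank_inj eq] :=
    ltngtP (enum_rank i) (enum_rank j).
  - exact: same.
  - by rewrite edistC addrC; apply: same.
  - by rewrite eq eqxx in ij.
have sepij : s i + s j <= edist (z i) (z j).
  have /(pairwiseP (finset.set0, (0, 0), 0)) {}sep := sep.
  have [lt|gt|eq] := ltngtP (g i) (g j).
  - exact: (sep _ _ (gA i iA) (gA j jA)).
  - rewrite edistC addrC; exact: (sep _ _ (gA j jA) (gA i iA)).
  - by rewrite eq eqxx in gij.
have := cz i iA; have := cz j jA.
have := edist_triangle (z i) (c i) (z j).
have := edist_triangle (c i) (c j) (z j).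
rewrite (edistC (z i) (c i)); lra.
Qed.

(** * Pappus chains *)

(** The Pappus chain in the arbelos of the disk of radius 1 centered at
    [(- b, 0)] and the surrounding disk of radius [1 + b]: member [n] touches
    both, and its center is at height [2 * n] times its radius.  Member 0 is
    the disk of radius [b]. *)
Definition pappus_rad (R : realType) (b n : R) : R :=
  b * (1 + b) / (1 + b + (n * b) ^+ 2).

Definition pappus_ctr (R : realType) (b n : R) : R * R :=
  ((2 + b) / b * pappus_rad b n - (1 + b), 2 * n * pappus_rad b n).

Lemma pappus_den_gt0 (R : realType) (b n : R) : 0 < b ->
  0 < 1 + b + (n * b) ^+ 2.
Proof. by move=> b0; have := sqr_ge0 (n * b); lra. Qed.

Lemma pappus_rad_gt0 (R : realType) (b n : R) : 0 < b -> 0 < pappus_rad b n.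
Proof.
by move=> b0; rewrite divr_gt0 ?pappus_den_gt0 // mulr_gt0 //; lra.
Qed.

Lemma pappus_rad_le (R : realType) (b n : R) : 0 < b -> pappus_rad b n <= b.
Proof.
move=> b0; rewrite ler_pdivrMr ?pappus_den_gt0 // ler_pM2l //.
by have := sqr_ge0 (n * b); lra.
Qed.

Lemma pappus_outer (R : realType) (b n : R) : 0 < b ->
  edist (pappus_ctr b n) (0, 0) + pappus_rad b n = 1 + b.
Proof.
move=> b0; have d0 := lt0r_neq0 (pappus_den_gt0 n b0).
have rb := pappus_rad_le n b0.
suff -> : edist (pappus_ctr b n) (0, 0) = 1 + b - pappus_rad b n by ring.
rewrite -[RHS]ger0_norm -?sqrtr_sqr; last lra.
congr Num.sqrt; rewrite /pappus_ctr /pappus_rad /=; field.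
by rewrite d0 lt0r_neq0.
Qed.

Lemma pappus_inner (R : realType) (b n : R) : 0 < b ->
  edist (- b, 0) (pappus_ctr b n) = 1 + pappus_rad b n.
Proof.
move=> b0; have d0 := lt0r_neq0 (pappus_den_gt0 n b0).
have r0 := pappus_rad_gt0 n b0.
rewrite -[RHS]ger0_norm -?sqrtr_sqr; last lra.
congr Num.sqrt; rewrite /pappus_ctr /pappus_rad /=; field.
by rewrite d0 lt0r_neq0.
Qed.

(** Inversion at the point of tangency turns the chain into a pile of equal
    disks at heights [n].  For two disks, the squared distance between the
    centers minus the square of the sum of the radii, divided by the product of
    the radii, is invariant under inversion up to sign. *)
Lemma pappus_sep (R : realType) (b m n : R) : 0 < b -> 1 <= (n - m) ^+ 2 ->
  pappus_rad b m + pappus_rad b n <= edist (pappus_ctr b m) (pappus_ctr b n).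
Proof.
move=> b0 mn; have m0 := pappus_rad_gt0 m b0; have n0 := pappus_rad_gt0 n b0.
rewrite le_edist; last lra.
rewrite -subr_ge0.
have -> : ((pappus_ctr b m).1 - (pappus_ctr b n).1) ^+ 2 +
    ((pappus_ctr b m).2 - (pappus_ctr b n).2) ^+ 2 -
    (pappus_rad b m + pappus_rad b n) ^+ 2 =
    4 * (pappus_rad b m * pappus_rad b n) * ((n - m) ^+ 2 - 1).
  have d0 := lt0r_neq0 (pappus_den_gt0 m b0).
  have e0 := lt0r_neq0 (pappus_den_gt0 n b0).
  rewrite /pappus_ctr /pappus_rad /=; field.
  by rewrite d0 e0 lt0r_neq0.
by rewrite mulr_ge0 ?subr_ge0 // mulr_ge0 // mulr_ge0 // ltW.
Qed.

(** [U] takes the disk of radius 1, and each entry of [l] a member of the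
    chain. *)
Lemma packs_pappus (R : realType) (T : finType) (rad : T -> R) (A : {set T})
    (H b : R) (U : {set T}) (l : seq ({set T} * R)) :
  (forall i, 0 < rad i) -> 0 < b -> 1 + b <= H ->
  \sum_(i in U) rad i <= 1 ->
  all (fun t : {set T} * R => \sum_(i in t.1) rad i <= pappus_rad b t.2) l ->
  pairwise (fun t t' : {set T} * R => 1 <= (t'.2 - t.2) ^+ 2) l ->
  (forall i, i \in A -> i \notin U ->
    has (fun t : {set T} * R => i \in t.1) l) ->
  packs rad A H.
Proof.
move=> r0 b0 bH U1 fit sep cov.
pose row (t : {set T} * R) := (t.1, pappus_ctr b t.2, pappus_rad b t.2).
apply: (@packs_rows _ _ _ _ _ ((U, (- b, 0), 1) :: map row l)) => //=.
- move=> i iA; have [//|iU] := boolP (i \in U).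
  by rewrite has_map; apply: cov.
- rewrite U1 /=; apply/andP; split.
    have -> : edist (- b, 0) (0, 0) = b :> R.
      by rewrite /edist /= subrr expr0n addr0 subr0 sqrtr_sqr normrN gtr0_norm.
    by rewrite addrC.
  rewrite all_map; apply: sub_all fit => t /= -> /=.
  by rewrite pappus_outer.
- apply/andP; split.
    rewrite all_map; apply/allP => t _ /=.
    by rewrite pappus_inner.
  rewrite pairwise_map; apply: sub_pairwise sep => t t' /=.
  exact: pappus_sep.
Qed.

(** * Three mutually tangent disks *)

(** For centers [z], the weighted sum of the squared distances between them is
    the weighted sum of their squared norms minus the square of the norm of
    their weighted mean; the last term is dropped. *)
Lemma packs_weights (R : realType) (T : finType) (rad : T -> R) (A : {set T})
    (H a b c : R) (u v w : T) :
  packs rad A H -> u \in A -> v \in A -> w \in A ->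
  u != v -> u != w -> v != w -> (forall i, 0 < rad i) ->
  0 <= a -> 0 <= b -> 0 <= c ->
  a * b * (rad u + rad v) ^+ 2 + a * c * (rad u + rad w) ^+ 2 +
    b * c * (rad v + rad w) ^+ 2 <=
  (a + b + c) * (a * (H - rad u) ^+ 2 + b * (H - rad v) ^+ 2 +
                 c * (H - rad w) ^+ 2).
Proof.
move=> [z [inH sep]] uA vA wA uv uw vw r0 a0 b0 c0.
have far i j : i \in A -> j \in A -> i != j ->
    (rad i + rad j) ^+ 2 <=
    ((z i).1 - (z j).1) ^+ 2 + ((z i).2 - (z j).2) ^+ 2.
  by move=> iA jA ij; rewrite -le_edist ?sep // addr_ge0 // ltW.
have near i : i \in A -> (z i).1 ^+ 2 + (z i).2 ^+ 2 <= (H - rad i) ^+ 2.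
  move=> /inH iH; have := edist_ge0 (z i) (0, 0) => e0.
  have := edist_le (z i) (0, 0) (d := H - rad i).
  by rewrite /= !subr0 => <-; lra.
have := ler_wpM2l (mulr_ge0 a0 b0) (far u v uA vA uv).
have := ler_wpM2l (mulr_ge0 a0 c0) (far u w uA wA uw).
have := ler_wpM2l (mulr_ge0 b0 c0) (far v w vA wA vw).
have L0 : 0 <= a + b + c by lra.
have := ler_wpM2l (mulr_ge0 L0 a0) (near u uA).
have := ler_wpM2l (mulr_ge0 L0 b0) (near v vA).
have := ler_wpM2l (mulr_ge0 L0 c0) (near w wA).
have := sqr_ge0 (a * (z u).1 + b * (z v).1 + c * (z w).1).
have := sqr_ge0 (a * (z u).2 + b * (z v).2 + c * (z w).2).
lra.
Qed.

(** For mutually tangent disks of radii 1, [b] and [c], let [g] be the inradius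
    of the triangle of their centers.  All quantities in play are rational in
    [b] and [g], which avoids the square root in the formula for the area:
    [c] is [soddy_third b g], the circle around the three disks has radius
    [soddy_outer b g], and the disk touching that circle and the disks of radii
    1 and [b] on the side away from [c] has radius [soddy_pocket b g].  The
    hypothesis [b <= g * (1 + b)] says that [c >= pappus_rad b 1], and
    [g ^+ 2 * (1 + 2 * b) <= b ^+ 2] that [c <= b]. *)
Definition soddy_den (R : realType) (b g : R) : R :=
  2 * g * b * (1 + b) - b ^+ 2 - g ^+ 2 * (1 + b + b ^+ 2).

Definition soddy_outer (R : realType) (b g : R) : R :=
  b * g ^+ 2 * (1 + b) / soddy_den b g.

Definition soddy_third (R : realType) (b g : R) : R :=
  g ^+ 2 * (1 + b) / (b - g ^+ 2).

Definition soddy_pocket (R : realType) (b g : R) : R :=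
  b * g ^+ 2 * (1 + b) /
    (b * (b - g ^+ 2) + 4 * g * (1 + b) * (g * (1 + b) - b)).

Lemma soddy_gap (R : realType) (b g : R) :
  0 < b -> g ^+ 2 * (1 + 2 * b) <= b ^+ 2 -> g ^+ 2 < b.
Proof.
move=> b0 gb; rewrite ltNge; apply/negP => h.
have : b * (1 + 2 * b) <= g ^+ 2 * (1 + 2 * b).
  apply: ler_wpM2r => //; lra.
by nra.
Qed.

Lemma soddy_g_lt (R : realType) (b g : R) : 0 < b -> 0 < g ->
  g ^+ 2 * (1 + 2 * b) <= b ^+ 2 -> g < b.
Proof.
move=> b0 g0 gb; rewrite ltNge; apply/negP => h.
have : b ^+ 2 <= g ^+ 2 by rewrite ler_sqr ?nnegrE // ltW.
have : 0 < g ^+ 2 * b by rewrite mulr_gt0 ?exprn_gt0.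
by nra.
Qed.

Lemma soddy_den_gt0 (R : realType) (b g : R) : 0 < b -> b <= 1 -> 0 < g ->
  b <= g * (1 + b) -> g ^+ 2 * (1 + 2 * b) <= b ^+ 2 -> 0 < soddy_den b g.
Proof.
move=> b0 b1 g0 bg gb.
have h : g * (1 + b + b ^+ 2) <= b * (1 + b).
  have b2 : 0 <= b ^+ 2 by exact: sqr_ge0.
  rewrite -ler_sqr ?nnegrE; [|by apply: mulr_ge0; lra|by apply: mulr_ge0; lra].
  rewrite !exprMn.
  have h1 : (1 + b + b ^+ 2) ^+ 2 <= (1 + 2 * b) * (1 + b) ^+ 2.
    rewrite expr2; apply: ler_pM; nra.
  have g2 : 0 <= g ^+ 2 by exact: sqr_ge0.
  apply: le_trans (ler_wpM2l g2 h1) _.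
  rewrite mulrA; apply: ler_wpM2r => //; exact: sqr_ge0.
rewrite /soddy_den.
have -> : 2 * g * b * (1 + b) - b ^+ 2 - g ^+ 2 * (1 + b + b ^+ 2) =
  b * (g * (1 + b) - b) + g * (b * (1 + b) - g * (1 + b + b ^+ 2)) by ring.
have h' : 0 <= g * (b * (1 + b) - g * (1 + b + b ^+ 2)).
  by rewrite mulr_ge0 ?subr_ge0 // ltW.
have h'' : 0 <= b * (g * (1 + b) - b) by rewrite mulr_ge0 ?subr_ge0 // ltW.
rewrite lt_def addr_ge0 // andbT; apply/eqP => e.
have e1 : b * (g * (1 + b) - b) = 0 by lra.
have e2 : g * (b * (1 + b) - g * (1 + b + b ^+ 2)) = 0 by lra.
move/eqP: e1; rewrite mulf_eq0 (gt_eqF b0) /= subr_eq0 => /eqP e1.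
move/eqP: e2; rewrite mulf_eq0 (gt_eqF g0) /= subr_eq0 => /eqP e2.
have : b * (1 + b) ^+ 2 = b * (1 + b + b ^+ 2).
  have -> : b * (1 + b) ^+ 2 = (b * (1 + b)) * (1 + b) by ring.
  rewrite e2; have -> : g * (1 + b + b ^+ 2) * (1 + b) =
    (g * (1 + b)) * (1 + b + b ^+ 2) by ring.
  by rewrite e1.
have b2 : 0 < b * b by rewrite mulr_gt0.
by nra.
Qed.

Lemma soddy_outer_ge1 (R : realType) (b g : R) :
  0 < soddy_den b g -> 1 <= soddy_outer b g.
Proof.
move=> d0; rewrite ler_pdivlMr // mul1r -subr_ge0.
have -> : b * g ^+ 2 * (1 + b) - soddy_den b g =
  (g * (1 + b) - b) ^+ 2 + (g * b) ^+ 2 by rewrite /soddy_den; ring.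
by rewrite addr_ge0 // sqr_ge0.
Qed.

(** The weights are the barycentric coordinates of the center of the circle
    that touches three mutually tangent disks from outside; with these weights
    the averaged inequality is an equality when the pan is that circle. *)
Lemma soddy_outer_le (R : realType) (b g : R) (T : finType) (rad : T -> R)
    (A : {set T}) (H : R) (u v w : T) :
  0 < b -> b <= 1 -> 0 < g ->
  b <= g * (1 + b) -> g ^+ 2 * (1 + 2 * b) <= b ^+ 2 ->
  packs rad A H -> u \in A -> v \in A -> w \in A ->
  u != v -> u != w -> v != w -> (forall i, 0 < rad i) ->
  rad u = 1 -> rad v = b -> rad w = soddy_third b g -> soddy_outer b g <= H.
Proof.
move=> b0 b1 g0 bg gb pk uA vA wA uv uw vw r0 ru rv rw.
rewrite leNgt; apply/negP => lt.
have e0 : 0 < b - g ^+ 2 by rewrite subr_gt0 (soddy_gap b0 gb).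
(* The weights are scaled by [b - g ^+ 2] to clear denominators. *)
pose l1 := b ^+ 2 + g ^+ 2 - g * b * (1 + b).
pose l2 := b * (1 + g ^+ 2) - g * (1 + b).
pose l3 := (b - g ^+ 2) * (g * (1 + b) - b) / g.
have gltb := soddy_g_lt b0 g0 gb.
have l1_gt0 : 0 < l1 by rewrite /l1; nra.
have l2_ge0 : 0 <= l2.
  rewrite subr_ge0 -ler_sqr ?nnegrE; [|nra|nra].
  rewrite !exprMn; have := sqr_ge0 (b * g); have := sqr_ge0 (b * g ^+ 2).
  nra.
have l3_ge0 : 0 <= l3.
  apply: divr_ge0; last exact: ltW.
  by apply: mulr_ge0; [exact: ltW|rewrite subr_ge0].
have := packs_weights pk uA vA wA uv uw vw r0 (ltW l1_gt0) l2_ge0 l3_ge0.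
rewrite ru rv rw.
have d0 := lt0r_neq0 (soddy_den_gt0 b0 b1 g0 bg gb).
have -> : l1 * l2 * (1 + b) ^+ 2 + l1 * l3 * (1 + soddy_third b g) ^+ 2 +
  l2 * l3 * (b + soddy_third b g) ^+ 2 =
  (l1 + l2 + l3) * (l1 * (soddy_outer b g - 1) ^+ 2 +
    l2 * (soddy_outer b g - b) ^+ 2 +
    l3 * (soddy_outer b g - soddy_third b g) ^+ 2).
  rewrite /l1 /l2 /l3 /soddy_third /soddy_outer /soddy_den; field.
  move: d0; rewrite /soddy_den => ->; by rewrite lt0r_neq0 // lt0r_neq0.
apply/negP; rewrite -ltNge ltr_pM2l; last lra.
have sq r : r <= H -> (H - r) ^+ 2 < (soddy_outer b g - r) ^+ 2.
  by move=> rH; rewrite ltr_sqr ?nnegrE; lra.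
have h1 := sq _ (packs_le uA pk); have h2 := sq _ (packs_le vA pk).
have h3 := sq _ (packs_le wA pk); rewrite ru rv rw in h1 h2 h3.
apply: ltr_leD; [apply: ltr_leD|].
- by rewrite ltr_pM2l.
- by rewrite ler_wpM2l // ltW.
- by rewrite ler_wpM2l // ltW.
Qed.

(** The center, at height [h], of a circle of radius [r] that touches the disks
    of radii 1 and [b] centered at the origin and at [(1 + b, 0)].  A negative
    [r] stands for a circle that surrounds the two disks. *)
Definition tangent_ctr (R : realType) (b r h : R) : R * R :=
  (((1 + r) ^+ 2 - (b + r) ^+ 2 + (1 + b) ^+ 2) / (2 * (1 + b)), h).

Definition soddy_ctr (R : realType) (b g : R) : R * R :=
  tangent_ctr b (- soddy_outer b g)
    (2 * soddy_outer b g * (g * (1 + b) - b) / (g * (1 + b))).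

Lemma edist_sub (R : realType) (o p q : R * R) :
  edist (p.1 - o.1, p.2 - o.2) (q.1 - o.1, q.2 - o.2) = edist p q.
Proof. by rewrite /edist /=; congr Num.sqrt; ring. Qed.

Lemma edist_eq (R : realType) (p q : R * R) (d : R) : 0 <= d ->
  (p.1 - q.1) ^+ 2 + (p.2 - q.2) ^+ 2 = d ^+ 2 -> edist p q = d.
Proof. by move=> d0; rewrite /edist => ->; rewrite sqrtr_sqr ger0_norm. Qed.

(** With equality to first order where [soddy_third b g] equals
    [pappus_rad b 1], the two pockets being equal there: after clearing
    denominators the difference has the factor [(g * (1 + b) - b) ^+ 2]. *)
Lemma soddy_pocket_ge (R : realType) (b g : R) : 0 < b -> 0 < g ->
  b <= g * (1 + b) -> g ^+ 2 < b ->
  2 * pappus_rad b 1 - soddy_third b g <= soddy_pocket b g.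
Proof.
move=> b0 g0 bg gb.
have e0 : 0 < b - g ^+ 2 by rewrite subr_gt0.
have v0 : 0 <= g * (1 + b) - b by rewrite subr_ge0.
have p0 : 0 < b * (b - g ^+ 2) + 4 * g * (1 + b) * (g * (1 + b) - b).
  apply: ltr_pwDl; first exact: mulr_gt0.
  by rewrite mulr_ge0 // mulr_ge0 ?mulr_ge0 //; lra.
have n0 := pappus_den_gt0 1 b0.
rewrite lerBlDr -subr_ge0 /pappus_rad /soddy_third /soddy_pocket.
have -> : b * g ^+ 2 * (1 + b) /
     (b * (b - g ^+ 2) + 4 * g * (1 + b) * (g * (1 + b) - b)) +
   g ^+ 2 * (1 + b) / (b - g ^+ 2) -
   2 * (b * (1 + b) / (1 + b + (1 * b) ^+ 2)) =
   2 * (1 + b) * (g * (1 + b) - b) ^+ 2 *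
     (2 * (g * (1 + b)) * (g * (1 + b) + b) - b * (b - g ^+ 2)) /
   ((b * (b - g ^+ 2) + 4 * g * (1 + b) * (g * (1 + b) - b)) *
    ((b - g ^+ 2) * (1 + b + (1 * b) ^+ 2))).
  field; rewrite mul1r in n0.
  by rewrite !lt0r_neq0.
apply: divr_ge0; last by rewrite !mulr_ge0 // ltW.
apply: mulr_ge0; first by rewrite mulr_ge0 ?sqr_ge0 //; lra.
have g2 := sqr_ge0 g.
move: (g * (1 + b)) bg => G bg.
have : b * b <= G * (G + b) by apply: ler_pM; lra.
have : 0 <= b * g ^+ 2 by rewrite mulr_ge0 // ltW.
by nra.
Qed.

(** The four disks are the three mutually tangent ones and the pocket, which
    takes a row of the disks in [U]. *)
Lemma packs_soddy (R : realType) (T : finType) (rad : T -> R) (A U : {set T})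
    (H b g : R) (u v w : T) :
  0 < b -> b <= 1 -> 0 < g ->
  b <= g * (1 + b) -> g ^+ 2 * (1 + 2 * b) <= b ^+ 2 ->
  (forall i, 0 < rad i) -> soddy_outer b g <= H ->
  rad u = 1 -> rad v = b -> rad w = soddy_third b g ->
  \sum_(i in U) rad i <= soddy_pocket b g ->
  (forall i, i \in A -> [|| i == u, i == v, i == w | i \in U]) ->
  packs rad A H.
Proof.
move=> b0 b1 g0 bg gb r0 bH ru rv rw rU cov.
have gap := soddy_gap b0 gb; have den0 := soddy_den_gt0 b0 b1 g0 bg gb.
have H1 := soddy_outer_ge1 den0.
have e0 : 0 < b - g ^+ 2 by rewrite subr_gt0.
have v0 : 0 <= g * (1 + b) - b by rewrite subr_ge0.
have p0 : 0 < b * (b - g ^+ 2) + 4 * g * (1 + b) * (g * (1 + b) - b).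
  apply: ltr_pwDl; first exact: mulr_gt0.
  by rewrite mulr_ge0 // mulr_ge0 ?mulr_ge0 //; lra.
have c0 : 0 < soddy_third b g by rewrite -rw.
have d0 : 0 < soddy_pocket b g.
  by rewrite divr_gt0 // !mulr_gt0 ?exprn_gt0 //; lra.
have cb : soddy_third b g <= b.
  by rewrite ler_pdivrMr //; nra.
have dc : soddy_pocket b g <= soddy_third b g.
  rewrite ler_pdivrMr //.
  have ce : soddy_third b g * (b - g ^+ 2) = g ^+ 2 * (1 + b).
    by rewrite divfK // lt0r_neq0.
  have : 0 <= soddy_third b g * (4 * g * (1 + b) * (g * (1 + b) - b)).
    apply: mulr_ge0; first exact: ltW.
    by rewrite mulr_ge0 // mulr_ge0 ?mulr_ge0 //; lra.
  have -> : b * g ^+ 2 * (1 + b) = b * (g ^+ 2 * (1 + b)) by ring.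
  by rewrite -ce; lra.
pose o := soddy_ctr b g.
pose c1 : R * R := (0, 0).
pose c2 : R * R := (1 + b, 0).
pose c3 := tangent_ctr b (soddy_third b g) (2 * g * b / (b - g ^+ 2)).
pose c4 := tangent_ctr b (soddy_pocket b g)
  (- (2 * soddy_pocket b g * (2 * (g * (1 + b)) - b) / (g * (1 + b)))).
have b1n0 : 1 + b != 0 by rewrite lt0r_neq0 //; lra.
have nz := (lt0r_neq0 b0, lt0r_neq0 g0, lt0r_neq0 e0, b1n0, lt0r_neq0 p0).
have dn0 := lt0r_neq0 den0.
have o1 : edist c1 o = soddy_outer b g - 1.
  apply: edist_eq; first lra.
  rewrite /c1 /o /soddy_ctr /tangent_ctr /=.
  by move: dn0; rewrite /soddy_outer /soddy_den => dn0; field; rewrite dn0 !nz.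
have o2 : edist c2 o = soddy_outer b g - b.
  apply: edist_eq; first lra.
  rewrite /c2 /o /soddy_ctr /tangent_ctr /=.
  by move: dn0; rewrite /soddy_outer /soddy_den => dn0; field; rewrite dn0 !nz.
have o3 : edist c3 o = soddy_outer b g - soddy_third b g.
  apply: edist_eq; first lra.
  rewrite /c3 /o /soddy_ctr /tangent_ctr /=.
  move: dn0; rewrite /soddy_outer /soddy_den /soddy_third => dn0.
  by field; rewrite dn0 !nz.
have o4 : edist c4 o = soddy_outer b g - soddy_pocket b g.
  apply: edist_eq; first lra.
  rewrite /c4 /o /soddy_ctr /tangent_ctr /=.
  move: dn0; rewrite /soddy_outer /soddy_den /soddy_pocket => dn0.
  by field; rewrite dn0 !nz.
have t12 : edist c1 c2 = 1 + b.
  by apply: edist_eq; [lra|rewrite /=; ring].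
have t13 : edist c1 c3 = 1 + soddy_third b g.
  apply: edist_eq; first lra.
  by rewrite /c1 /c3 /tangent_ctr /soddy_third /=; field; rewrite !nz.
have t23 : edist c2 c3 = b + soddy_third b g.
  apply: edist_eq; first lra.
  by rewrite /c2 /c3 /tangent_ctr /soddy_third /=; field; rewrite !nz.
have t14 : edist c1 c4 = 1 + soddy_pocket b g.
  apply: edist_eq; first lra.
  by rewrite /c1 /c4 /tangent_ctr /soddy_pocket /=; field; rewrite !nz.
have t24 : edist c2 c4 = b + soddy_pocket b g.
  apply: edist_eq; first lra.
  by rewrite /c2 /c4 /tangent_ctr /soddy_pocket /=; field; rewrite !nz.
have s34 : soddy_third b g + soddy_pocket b g <= edist c3 c4.
  have gltb := soddy_g_lt b0 g0 gb.
  have G0 : 0 < g * (1 + b) by rewrite mulr_gt0 //; lra.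
  have h3 : soddy_third b g <= c3.2.
    by rewrite /= /soddy_third ler_pM2r ?invr_gt0 //; nra.
  have h4 : soddy_pocket b g <= - c4.2.
    rewrite /= opprK ler_pdivlMr //.
    have -> : 2 * soddy_pocket b g * (2 * (g * (1 + b)) - b) =
      soddy_pocket b g * (2 * (2 * (g * (1 + b)) - b)) by ring.
    by rewrite ler_pM2l //; lra.
  rewrite le_edist; last by lra.
  apply: (@le_trans _ _ ((c3.2 - c4.2) ^+ 2)); last by rewrite lerDr sqr_ge0.
  by rewrite ler_sqr ?nnegrE; lra.
pose sh (p : R * R) : R * R := (p.1 - o.1, p.2 - o.2).
have sho p : edist (sh p) (0, 0) = edist p o.
  by rewrite -(edist_sub o p o) !subrr.
have shs p q : edist (sh p) (sh q) = edist p q by exact: edist_sub.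
apply: (@packs_rows _ _ _ _ _
  [:: ([set u]%SET, sh c1, 1); ([set v]%SET, sh c2, b);
      ([set w]%SET, sh c3, soddy_third b g); (U, sh c4, soddy_pocket b g)])
  => //=.
- by move=> i /cov; rewrite !inE !orbF.
- rewrite !big_set1 ru rv rw !lexx rU !sho o1 o2 o3 o4 /= andbT.
  by apply/and4P; split; lra.
- by rewrite !shs t12 t13 t23 t14 t24 !lexx s34.
Qed.

(** * The golden ratio and the pockets *)

Lemma golden_sqr (R : realType) : golden R ^+ 2 = golden R + 1.
Proof.
have h : Num.sqrt 5 ^+ 2 = 5 :> R by rewrite sqr_sqrtr // ler0n.
rewrite /golden; move: (Num.sqrt 5) h => s h.
have -> : ((1 + s) / 2) ^+ 2 = (1 + 2 * s + s ^+ 2) / 4 by field.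
by rewrite h; field.
Qed.

Lemma golden_gt (R : realType) : 8 / 5 < golden R.
Proof.
rewrite /golden; suff : 11 / 5 < Num.sqrt 5 :> R by lra.
by rewrite -ltr_sqr ?nnegrE ?sqrtr_ge0 ?sqr_sqrtr ?ler0n //; lra.
Qed.

Lemma golden_lt (R : realType) : golden R < 81 / 50.
Proof.
rewrite /golden; suff : Num.sqrt 5 < 56 / 25 :> R by lra.
by rewrite -ltr_sqr ?nnegrE ?sqrtr_ge0 ?sqr_sqrtr ?ler0n //; lra.
Qed.

(** The two bounds on [D] meet at [b = (golden R)^-1], where both are equal to
    [2 * pappus_rad b 1]; below that point the first one decides, above it the
    second. *)
Lemma golden_pockets (R : realType) (b D : R) : 0 < b -> b <= 1 -> 0 <= D ->
  D <= golden R * b -> b + D <= golden R ->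
  D <= 2 * pappus_rad b 1 /\ D <= golden R * (2 * pappus_rad b 2).
Proof.
move=> b0 b1 D0; have := golden_sqr R; have := golden_gt R; have := golden_lt R.
move: (golden R) => f f1 f0 f2 D1 D2.
rewrite /pappus_rad !mulrA !ler_pdivlMr ?pappus_den_gt0 // mul1r.
have b2 := sqr_ge0 b; have b3 : 0 <= b ^+ 3 by rewrite exprn_ge0 // ltW.
split.
  have [le|/ltW ge] := lerP (f * b) 1.
    apply: (@le_trans _ _ (f * b * (1 + b + b ^+ 2))).
      by apply: ler_wpM2r => //; lra.
    have -> : f * b * (1 + b + b ^+ 2) = b * (f * (1 + b + b ^+ 2)) by ring.
    rewrite -!mulrA [leRHS]mulrCA; apply: ler_wpM2l; first exact: ltW.
    by nra.
  apply: (@le_trans _ _ ((f - b) * (1 + b + b ^+ 2))).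
    by apply: ler_wpM2r; lra.
  by nra.
have [le|/ltW ge] := lerP (f * b) 1.
  apply: (@le_trans _ _ (f * b * (1 + b + (2 * b) ^+ 2))).
    by apply: ler_wpM2r => //; nra.
  by nra.
apply: (@le_trans _ _ ((f - b) * (1 + b + (2 * b) ^+ 2))).
  by apply: ler_wpM2r => //; nra.
by nra.
Qed.

(** * Adding a small disk to a packing *)

Lemma ex_max_rad (R : realType) (T : finType) (rad : T -> R) (A : {set T}) i0 :
  i0 \in A -> exists2 m, m \in A & forall i, i \in A -> rad i <= rad m.
Proof.
by move=> iA; case: (arg_maxP rad iA) => m mA mmax; exists m.
Qed.

Lemma sum_rad_sub (R : realType) (T : finType) (rad : T -> R) (A B : {pred T}) :
  (forall i, 0 < rad i) -> {subset A <= B} ->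
  \sum_(i in A) rad i <= \sum_(i in B) rad i.
Proof.
move=> r0 AB; rewrite [leRHS](bigID (mem A)) /=.
rewrite -[leLHS]addr0 lerD ?sumr_ge0 // => [|i _]; last exact: ltW.
rewrite le_eqVlt; apply/orP; left; apply/eqP; apply: eq_bigl => i.
by case iA : (i \in A); rewrite ?andbF ?andbT // AB.
Qed.

(** The consequence of [rho I <= golden R] for the rings in [X], in terms of the
    radii alone so that it survives scaling. *)
Definition light_tails (R : realType) (T : finType) (rad : T -> R)
    (X : {set T}) : Prop :=
  forall i, i \in X -> \sum_(j in X | rad j < rad i) rad j <= golden R * rad i.

Lemma light_tail_sub (R : realType) (T : finType) (rad : T -> R)
    (X Y : {set T}) (i : T) :
  (forall i, 0 < rad i) -> light_tails rad X -> i \in X ->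
  (forall j, j \in Y -> j \in X /\ rad j < rad i) ->
  \sum_(j in Y) rad j <= golden R * rad i.
Proof.
move=> r0 lt iX YX; apply: le_trans (lt i iX).
by apply: sum_rad_sub => // j /YX[jX ji]; rewrite unfold_in jX.
Qed.

(** The case of [pack_last] in which the two largest children are [u], of radius
    1, and [v]. *)
Lemma pack_last_unit (R : realType) (T : finType) (rad : T -> R)
    (X C : {set T}) (H : R) (n k u v : T) :
  (forall i, 0 < rad i) -> injective rad -> light_tails rad X ->
  C \subset X -> n \in X -> k \in X -> u \in C -> v \in C ->
  rad u = 1 -> rad v < 1 ->
  (forall i, i \in C -> i != u -> i != v -> rad i < rad v) ->
  rad n < rad k -> rad k < rad v -> (forall i, i \in C -> rad n < rad i) ->
  packs rad C H -> packs rad (n |: C)%SET H.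
Proof.
move=> r0 rI lt /fintype.subsetP CX nX kX uC vC ru rv vmax nk kv nC pk.
set b := rad v in rv vmax kv *.
have b0 : 0 < b by exact: r0.
have uv : u != v by apply/eqP => e; move: rv; rewrite /b -e ru ltxx.
have bH : 1 + b <= H by rewrite -ru; apply: packs_le2 pk.
pose S (Y : {set T}) := \sum_(i in Y) rad i.
have S1 (i : T) (Y : {set T}) : i \in Y -> S Y = rad i + S (Y :\ i)%SET.
  by move=> iY; rewrite /S (big_setD1 i).
pose D := S [set j in X | rad j < b]%SET.
have D0 : 0 <= D by apply: sumr_ge0 => i _; exact: ltW.
have Dv : D <= golden R * b.
  apply: (light_tail_sub (i := v) r0 lt) => [|j]; first exact: CX.
  by rewrite inE => /andP[].
have Du : b + D <= golden R.
  have -> : b + D = S (v |: [set j in X | rad j < b])%SET.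
    by rewrite /S big_setU1 // inE ltxx andbF.
  rewrite -[leRHS]mulr1 -ru.
  apply: (light_tail_sub (i := u) r0 lt) => [|j]; first exact: CX.
  rewrite !inE ru => /orP[/eqP ->|/andP[-> jb]]; first by split; [exact: CX|].
  by split=> //; apply: lt_trans rv.
have [Dx Dy] := golden_pockets b0 (ltW rv) D0 Dv Du.
have f2 := golden_sqr R; have f0 := golden_gt R; have f1 := golden_lt R.
set x := pappus_rad b 1 in Dx; set y := pappus_rad b 2 in Dy.
pose Rst := ((n |: C) :\ u :\ v)%SET.
have RstD i : i \in Rst -> i \in X /\ rad i < b.
  rewrite !inE => /and3P[iv iu /orP[/eqP ->|iC]]; last first.
    by split; [exact: CX|exact: vmax].
  by split=> //; apply: lt_trans kv.
have nu : n != u by apply/eqP => e; have := nC u uC; rewrite e ltxx.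
have nv : n != v by apply/eqP => e; have := nC v vC; rewrite e ltxx.
have nR : n \in Rst by rewrite !inE nv nu eqxx.
have SD (Y : {set T}) : Y \subset Rst -> S Y <= D.
  move=> /fintype.subsetP YR; apply: sum_rad_sub => // i /YR /RstD[iX ib].
  by rewrite inE iX.
have nx : rad n <= x.
  suff : rad n + rad k <= D by lra.
  have kn : k != n by apply/eqP => e; move: nk; rewrite e ltxx.
  have -> : rad n + rad k = S [set n; k]%SET.
    by rewrite /S big_setU1 ?big_set1 // inE eq_sym.
  apply: sum_rad_sub => // i; rewrite !inE => /orP[] /eqP ->.
    by rewrite nX; apply: lt_trans kv.
  by rewrite kX.
have [c cR cmax] := ex_max_rad rad nR.
have [cX cb] := RstD c cR.
pose R1 := (Rst :\ c)%SET.
have R1c : S R1 <= golden R * rad c.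
  apply: (light_tail_sub (i := c) r0 lt) => // i; rewrite 2!inE => /andP[ic iR].
  have [iX _] := RstD i iR; split=> //; rewrite lt_neqAle cmax // andbT.
  by apply: contra ic => /eqP /rI ->.
have cR1 : rad c + S R1 <= D by rewrite -S1 // SD.
have S0 Y : 0 <= S Y by apply: sumr_ge0 => i _; exact: ltW.
have cov i : i \in (n |: C)%SET -> [|| i == u, i == v, i == c | i \in R1].
  move=> iC; rewrite /R1 /Rst !in_setD1 iC andbT.
  by case: (i == u); case: (i == v); case: (i == c).
have pap0 : pappus_rad b 0 = b.
  by rewrite /pappus_rad mul0r expr0n addr0 mulfK // lt0r_neq0 //; lra.
have [cx|xc] := lerP (rad c) x.
  have [R10|[i1 i1R]] := set_0Vmem R1.
    apply: (@packs_pappus _ _ _ _ _ b [set u]%SET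
      [:: ([set v]%SET, 0); ([set c]%SET, 1)]) => //=.
    - by rewrite big_set1 ru.
    - by rewrite !big_set1 pap0 lexx cx.
    - by rewrite subr0 expr1n lexx.
    - by move=> i /cov; rewrite R10 !inE orbF => /or3P[] /eqP ->;
        rewrite ?eqxx ?orbT.
  have [m mR mmax] := ex_max_rad rad i1R.
  pose R2 := (R1 :\ m)%SET.
  have mRst : m \in Rst by move: mR; rewrite !inE => /andP[].
  have [mX _] := RstD m mRst.
  have R2m : S R2 <= golden R * rad m.
    apply: (light_tail_sub (i := m) r0 lt) => // i; rewrite 2!inE => /andP[im iR].
    have [|iX _] := RstD i; first by move: iR; rewrite in_setD1 => /andP[].
    split=> //; rewrite lt_neqAle mmax // andbT.
    by apply: contra im => /eqP /rI ->.
  have mR2 : rad m + S R2 = S R1 by rewrite -S1.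
  have mc := cmax m mRst.
  have pap1 : pappus_rad b (-1) = x by rewrite /x /pappus_rad !mulNr sqrrN.
  have cov2 (i : T) (A B : {set T}) :
      (A = [set m]%SET /\ B = R2) \/ (A = R2 /\ B = [set m]%SET) ->
      i \in (n |: C)%SET -> i \notin [set u]%SET ->
      [|| i \in [set v]%SET, i \in [set c]%SET, i \in A | i \in B].
    move=> AB /cov; rewrite !finset.in_set1 => /or4P[->|->|->|iR] //.
      by rewrite orbT.
    have : (i \in [set m]%SET) || (i \in R2).
      by rewrite finset.in_set1 in_setD1 iR andbT orbN.
    by move: AB => [[-> ->]|[-> ->]] /orP[] -> ; rewrite ?orbT.
  (* [c] takes one pocket; [m] and the rest [R2] share the other pocket and
     the smaller third one, to which [R2] goes if it fits there. *)
  have [R2y|yR2] := lerP (S R2) y.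
    apply: (@packs_pappus _ _ _ _ _ b [set u]%SET
      [:: ([set v]%SET, 0); ([set c]%SET, 1); ([set m]%SET, -1); (R2, 2)])
      => //=.
    - by rewrite big_set1 ru.
    - rewrite !big_set1 pap0 pap1 lexx cx R2y (le_trans mc) //.
    - by rewrite !andbT; apply/and3P; split; lra.
    - by move=> i iC iU; rewrite orbF cov2 //; left.
  apply: (@packs_pappus _ _ _ _ _ b [set u]%SET
    [:: ([set v]%SET, 0); ([set c]%SET, 1); (R2, -1); ([set m]%SET, 2)])
    => //=.
  - by rewrite big_set1 ru.
  - rewrite !big_set1 pap0 pap1 lexx cx /= andbT -/y -/(S R2).
    have := S0 R2; move: mR2 R2m yR2; set s2 := S R2 => mR2 R2m yR2 s20.
    have fpos : 0 < golden R by lra.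
    have f1R : golden R * S R1 <= D.
      rewrite -(ler_pM2l fpos) mulrA -expr2 f2.
      have := ler_wpM2l (ltW fpos) cR1; lra.
    have Sy : S R1 <= 2 * y.
      by rewrite -(ler_pM2l fpos); apply: le_trans f1R Dy.
    have s2m : golden R * s2 <= golden R * (golden R * rad m).
      by rewrite ler_pM2l.
    have fs : golden R ^+ 2 * s2 <= D.
      apply: le_trans f1R; rewrite -mR2 f2; lra.
    have : 2 * s2 <= golden R ^+ 2 * s2 by rewrite ler_wpM2r // f2; lra.
    by move=> ?; apply/andP; split; lra.
  - by rewrite !andbT; apply/and3P; split; lra.
  - by move=> i iC iU; rewrite orbF cov2 //; right.
(* The largest remaining disk [c] is too big for a pocket.  It is then not
   [n], so it comes from the given packing, and the container holds the outer
   Soddy circle of [u], [v] and [c]. *)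
have cC : c \in C.
  move: cR; rewrite !inE => /and3P[_ _ /orP[/eqP e|//]].
  by move: xc; rewrite e ltNge nx.
have cu : u != c by apply: contraTneq cR => <-; rewrite !inE eqxx andbF.
have cv : v != c by apply: contraTneq cR => <-; rewrite !inE eqxx.
move: (r0 c) => c0.
pose g := Num.sqrt (b * rad c / (1 + b + rad c)).
have den : 0 < 1 + b + rad c by lra.
have g0 : 0 < g by rewrite sqrtr_gt0 divr_gt0 // mulr_gt0.
have g2 : g ^+ 2 * (1 + b + rad c) = b * rad c.
  by rewrite sqr_sqrtr ?divfK ?lt0r_neq0 // divr_ge0 ?mulr_ge0 // ltW.
have gb : g ^+ 2 * (1 + 2 * b) <= b ^+ 2.
  by rewrite -(ler_pM2r den) mulrAC g2; nra.
have bg : b <= g * (1 + b).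
  rewrite -ler_sqr ?nnegrE; [|exact: ltW|by rewrite mulr_ge0 //; lra].
  rewrite exprMn -(ler_pM2r den) [leRHS]mulrAC g2.
  move: xc; rewrite /x /pappus_rad ltr_pdivrMr ?pappus_den_gt0 // mul1r => xc.
  have {}xc := ltW xc; rewrite -(ler_pM2l b0) in xc.
  by lra.
have gap := soddy_gap b0 gb.
have cE : rad c = soddy_third b g.
  have e0 : b - g ^+ 2 != 0 by rewrite subr_eq0 gt_eqF.
  by apply: (mulIf e0); rewrite divfK //; lra.
have oH : soddy_outer b g <= H.
  exact: (soddy_outer_le b0 (ltW rv) g0 bg gb pk uC vC cC).
apply: (packs_soddy b0 (ltW rv) g0 bg gb r0 oH ru erefl cE (U := R1)) => //.
apply: le_trans (soddy_pocket_ge b0 g0 bg gap).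
by rewrite -cE -/x -/(S R1); lra.
Qed.

Lemma packs_inj (R : realType) (T : finType) (rad : T -> R) (A B : {set T})
    (H : R) (s : T -> T) :
  {in A, forall i, s i \in B /\ rad i <= rad (s i)} -> {in A &, injective s} ->
  packs rad B H -> packs rad A H.
Proof.
move=> sB sI [c [c1 c2]]; exists (c \o s); split=> [i iA|i j iA jA ij] /=.
  by have [sBi le] := sB i iA; have := c1 _ sBi; lra.
have [sBi lei] := sB i iA; have [sBj lej] := sB j jA.
apply: le_trans (c2 _ _ sBi sBj _); first exact: lerD.
by apply: contra ij => /eqP /sI ->.
Qed.

Lemma packs1 (R : realType) (T : finType) (rad : T -> R) (i : T) (H : R) :
  rad i <= H -> packs rad [set i]%SET H.
Proof.
move=> iH; exists (fun=> (0, 0)); split=> [j|j k]; rewrite !finset.in_set1.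
  by move=> /eqP ->; rewrite edistxx add0r.
by move=> /eqP -> /eqP ->; rewrite eqxx.
Qed.

(** A container with several children can refuse [n] only if the second largest
    child is next to [n] in size.  The ring [k] matters for a container with just two children: it forces
    [n] to be smaller than half of the tail, hence to fit into a pocket. *)
Lemma pack_last (R : realType) (T : finType) (rad : T -> R)
    (X C : {set T}) (H : R) (n k u v : T) :
  (forall i, 0 < rad i) -> injective rad -> light_tails rad X ->
  C \subset X -> n \in X -> k \in X -> u \in C -> v \in C -> rad v < rad u ->
  rad n < rad k -> rad k < rad v -> (forall i, i \in C -> rad n < rad i) ->
  packs rad C H -> packs rad (n |: C)%SET H.
Proof.
move=> r0 rI lt CX nX kX uC vC vu nk kv nC pk.
have [u0 u0C u0max] := ex_max_rad rad uC.
have vu0 : v \in (C :\ u0)%SET.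
  rewrite in_setD1 vC andbT; apply: contraTneq vu => ->.
  by rewrite -leNgt u0max.
have [v0 + v0max] := ex_max_rad rad vu0.
rewrite in_setD1 => /andP[v0u0 v0C].
have lt_of i : i \in C -> i != u0 -> i != v0 -> rad i < rad v0.
  move=> iC iu iv; rewrite lt_neqAle v0max ?in_setD1 ?iu // andbT.
  by apply: contra iv => /eqP /rI ->.
have v0u0lt : rad v0 < rad u0.
  by rewrite lt_neqAle u0max // andbT; apply: contra v0u0 => /eqP /rI ->.
have s0 : 0 < (rad u0)^-1 by rewrite invr_gt0.
have un := lt0r_neq0 (r0 u0).
pose rad1 i := (rad u0)^-1 * rad i.
suff : packs rad1 (n |: C)%SET ((rad u0)^-1 * H).
  move/(packs_scale (r0 u0)); rewrite mulVKf //.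
  by under [fun i => _ * rad1 i]boolp.funext do rewrite mulVKf //.
rewrite /rad1.
apply: (@pack_last_unit _ _ _ X C _ n k u0 v0) => //.
- by move=> i; rewrite mulr_gt0.
- by move=> i j /(mulfI (lt0r_neq0 s0)) /rI.
- move=> i iX; rewrite mulrCA.
  under eq_bigl do rewrite ltr_pM2l //.
  by rewrite -mulr_sumr ler_pM2l // lt.
- by rewrite mulVf.
- by rewrite -(mulVf un) ltr_pM2l.
- by move=> i iC iu iv; rewrite ltr_pM2l // lt_of.
- by rewrite ltr_pM2l.
- by rewrite ltr_pM2l // (lt_le_trans kv) // v0max.
- by move=> i iC; rewrite ltr_pM2l // nC.
- exact: packs_scale.
Qed.

(** * Extending a placement *)

Lemma outer_ltE (R : realType) (I : instance R) (i j : 'I_(nrings I)) :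
  (outer I j < outer I i) = (i < j)%N.
Proof.
have [lt|gt|/ord_inj ->] := ltngtP i j; last by rewrite ltxx.
  exact: outer_decr.
by apply/negbTE; rewrite -leNgt ltW // outer_decr.
Qed.

Lemma outer_inj (R : realType) (I : instance R) : injective (outer I).
Proof.
move=> i j ij; have [lt|lt|/ord_inj //] := ltngtP i j.
  by have := outer_decr lt; rewrite ij ltxx.
by have := outer_decr lt; rewrite ij ltxx.
Qed.

Lemma rho_light_tails (R : realType) (I : instance R)
    (X : {set 'I_(nrings I)}) :
  rho I <= golden R -> light_tails (outer I) X.
Proof.
move=> rI i iX; rewrite -ler_pdivrMr ?outer_gt0 //; apply: le_trans rI.
apply: (@le_trans _ _ ((\sum_(j < nrings I | (i < j)%N) outer I j) / outer I i)).
  rewrite ler_pM2r ?invr_gt0 ?outer_gt0 //.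
  apply: (@sum_rad_sub _ _ _ [pred j | (j \in X) && (outer I j < outer I i)]
            [pred j : 'I__ | (i < j)%N]) => [j|j]; first exact: outer_gt0.
  by rewrite !inE outer_ltE => /andP[].
exact: (@le_bigmax _ R _ 0 (fun i : 'I_(nrings I) =>
  (\sum_(j < nrings I | (i < j)%N) outer I j) / outer I i) i).
Qed.

Definition children (R : realType) (I : instance R) (S : {set 'I_(nrings I)})
    (f : 'I_(nrings I) -> container I) (c : container I) :=
  [set i in S | f i == c]%SET.

Definition present (R : realType) (I : instance R) (S : {set 'I_(nrings I)})
    (c : container I) : bool :=
  if c is Some j then j \in S else true.

(** If no container admits [n], any two siblings under [f] include the last ring
    of [S].  Suppose that [i] is the first ring on which [p] and [f] differ.  If
    [p i] has a child [u] before [i] under [f], then [u] and [i] fit together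
    there, hence so do [n] and the children of [p i] under [f].  Otherwise all
    these children come after [i]; but the rings up to [i] have distinct parents
    under [f], and there are only as many containers before [i], [p i] among
    them. *)
Lemma placement_extends (R : realType) (I : instance R)
    (S : {set 'I_(nrings I)}) (f p : 'I_(nrings I) -> container I)
    (n : 'I_(nrings I)) :
  rho I <= golden R -> (forall i, i \in S -> (i < n)%N) ->
  placement S f -> placement (n |: S)%SET p ->
  exists c, present S c /\
    packable (outer I) (n |: children S f c)%SET (region_radius c).
Proof.
move=> rI Sn [fpar fpk] [ppar ppk].
have r0 := @outer_gt0 R I.
pose avail := present S.
have {}fpk c : packs (outer I) (children S f c) (region_radius c).
  by apply/packableP => //; apply: fpk.
have {}ppk c : packs (outer I) (children (n |: S)%SET p c) (region_radius c).
  by apply/packableP => //; apply: ppk.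
have chP c i : i \in children S f c = (i \in S) && (f i == c).
  by rewrite inE.
apply: contrapT => no.
have {}no c : avail c ->
    ~ packs (outer I) (n |: children S f c)%SET (region_radius c).
  by move=> ac pk; apply: no; exists c; split; [exact: ac|exact/packableP].
have tails X : light_tails (outer I) X by exact: rho_light_tails.
have last c u v k : avail c -> u \in children S f c -> v \in children S f c ->
    (u < v)%N -> k \in S -> (k <= v)%N.
  move=> ac uC vC uv kS; rewrite leqNgt; apply/negP => vk.
  apply: (no c ac).
  apply: (pack_last r0 (@outer_inj _ I) (tails (n |: S)%SET) _ _ _ uC vC
    (k := k)); rewrite ?outer_ltE ?in_setU1 ?eqxx ?kS ?orbT ?Sn //.
    apply/fintype.subsetP => i; rewrite chP in_setU1 => /andP[-> _].
    by rewrite orbT.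
  by move=> i; rewrite chP outer_ltE => /andP[/Sn].
have pf : forall m (i : 'I_(nrings I)), (i < m)%N -> i \in S -> p i = f i.
  elim=> [//|m IH] i im iS; apply/eqP; apply/negP => /negP pfi.
  have {}IH (j : 'I_(nrings I)) : (j < i)%N -> j \in S -> p j = f j.
    by move=> ji; apply: IH; apply: leq_trans ji _.
  have iU : i \in (n |: S)%SET by rewrite in_setU1 iS orbT.
  have id : outer I i <= region_radius (p i).
    by apply: packs_le (ppk (p i)); rewrite !inE iS orbT eqxx.
  have parent_lt (j : 'I_(nrings I)) : p i = Some j -> (j < i)%N /\ j \in S.
    move=> pj; have [jU ij] := ppar i j iU pj.
    have ji : (j < i)%N.
      by rewrite -outer_ltE; apply: le_lt_trans ij (hole_lt_outer j).
    split=> //; move: jU; rewrite in_setU1 => /orP[/eqP jn|//].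
    by move: ji; rewrite jn ltnNge (ltnW (Sn i iS)).
  have av : avail (p i) by case E : (p i) => [j|//]; have [] := parent_lt j E.
  have [C0|[u0 u0C]] := set_0Vmem (children S f (p i)).
    apply: (no _ av); rewrite C0 finset.setU0; apply: packs1; apply: le_trans id.
    by rewrite ltW // outer_ltE Sn.
  have [u /andP[uC ui]|nou] :=
      pickP (fun u : 'I_(nrings I) => (u \in children S f (p i)) && (u < i)%N).
    apply: (no _ av).
    have uS : u \in S by move: uC; rewrite chP => /andP[].
    have pu : p u = p i by rewrite IH //; move: uC; rewrite chP => /andP[_ /eqP].
    have iN : i \notin children S f (p i) by rewrite chP eq_sym (negbTE pfi) andbF.
    have uipk : packs (outer I) [set u; i]%SET (region_radius (p i)).
      apply: packs_sub (ppk (p i)); apply/fintype.subsetP => j.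
      by rewrite !inE => /orP[] /eqP ->; rewrite ?iS ?uS ?pu eqxx orbT.
    have after v : v \in children S f (p i) -> v != u -> (i < v)%N.
      move=> vC vu; have vi : v != i by apply: contraTneq vC => ->.
      have iv : (i <= v)%N -> (i < v)%N.
        rewrite ltn_neqAle eq_sym => ->; rewrite andbT.
        by apply: contra vi => /eqP /ord_inj ->.
      have [uv|vu'|/ord_inj e] := ltngtP u v; last by rewrite e eqxx in vu.
        by apply: iv; apply: (last _ _ _ _ av uC vC uv iS).
      have := last _ _ _ _ av vC uC vu' iS.
      by rewrite leqNgt ui.
    have [v /andP[vC vu]|nov] :=
        pickP (fun v => (v \in children S f (p i)) && (v != u)).
      have vS : v \in S by move: vC; rewrite chP => /andP[].
      have iv := after v vC vu.
      (* The children are [u] and the last ring [v]: first add [n] to [u] and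
         [i], then put [v] in the place of the larger [i]. *)
      have : packs (outer I) (n |: [set u; i])%SET (region_radius (p i)).
        apply: (pack_last r0 (@outer_inj _ I) (tails (n |: S)%SET) _ _ _
          _ _ _ _ _ _ uipk (k := v) (u := u) (v := i));
          rewrite ?outer_ltE ?in_setU1 ?eqxx ?vS ?orbT ?Sn ?inE ?eqxx ?orbT //.
          by apply/fintype.subsetP => j; rewrite !inE => /orP[] /eqP ->;
            rewrite ?iS ?uS orbT.
        by move=> j; rewrite !inE outer_ltE => /orP[] /eqP ->; rewrite Sn.
      have only w : w \in children S f (p i) -> w = u \/ w = v.
        move=> wC; have [->|wu] := eqVneq w u; [by left|right].
        have wS : w \in S by move: wC; rewrite chP => /andP[].
        have uw : (u < w)%N := ltn_trans ui (after w wC wu).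
        have uv : (u < v)%N := ltn_trans ui iv.
        apply: ord_inj; apply/eqP; rewrite eqn_leq.
        by rewrite (last _ _ _ _ av uC vC uv wS) (last _ _ _ _ av uC wC uw vS).
      have nS j : j \in S -> j != n.
        by move=> /Sn jn; apply: contraTneq jn => ->; rewrite ltnn.
      apply: (packs_inj (s := fun j => if j == v then i else j)) => [j|j k].
        rewrite in_setU1 => jU; case: (eqVneq j v) jU => [-> _|jv].
          by rewrite !inE eqxx !orbT; split=> //; rewrite ltW // outer_ltE.
        by move=> /orP[/eqP ->|/only[->|/eqP]];
          rewrite ?(negbTE jv) ?inE ?eqxx ?orbT.
      have iIn w : w \in (n |: children S f (p i))%SET -> w != i.
        rewrite in_setU1 => /orP[/eqP ->|]; first by rewrite eq_sym nS.
        by apply: contraTneq => ->.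
      move=> /iIn ji /iIn ki.
      case: (eqVneq j v) => [->|jv]; case: (eqVneq k v) => [->|kv] // e.
        by rewrite e eqxx in ki.
      by rewrite e eqxx in ji.
    apply: (packs_inj (s := fun j => if j == n then i else j)) uipk => [j|j k].
      rewrite in_setU1; case: (eqVneq j n) => [-> _|jn /= jC].
        by rewrite !inE eqxx orbT; split=> //; rewrite ltW // outer_ltE Sn.
      have := nov j; rewrite jC /= => /negbT; rewrite negbK => /eqP ->.
      by rewrite !inE eqxx.
    have iIn w : w \in (n |: children S f (p i))%SET -> w != i.
      rewrite in_setU1 => /orP[/eqP ->|].
        by apply: contraTneq (Sn i iS) => ->; rewrite ltnn.
      by apply: contraTneq => ->.
    move=> /iIn ji /iIn ki.
    case: (eqVneq j n) => [->|jv]; case: (eqVneq k n) => [->|kv] // e.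
      by rewrite e eqxx in ki.
    by rewrite e eqxx in ji.
  have u0S : u0 \in S by move: u0C; rewrite chP => /andP[].
  have iu0 : (i < u0)%N.
    rewrite ltnNge leq_eqVlt; apply/negP => /orP[/eqP/ord_inj e|lt].
      by move: u0C; rewrite e chP eq_sym (negbTE pfi) andbF.
    by have := nou u0; rewrite u0C lt.
  pose P := [set t in S | (t <= i)%N]%SET.
  pose E : {set container I} :=
    (None |: [set Some t | t in [set t in S | (t < i)%N]%SET])%SET.
  have finj : {in P &, injective f}.
    have aux t t' : t \in P -> t' \in P -> f t = f t' -> ~~ (t < t')%N.
      rewrite !inE => /andP[tS ti] /andP[t'S t'i] e; apply/negP => tt'.
      have avt : avail (f t).
        by case ft : (f t) => [j|//]; have [] := fpar _ _ tS ft.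
      have := last (f t) t t' u0 avt.
      rewrite !chP tS t'S e !eqxx => /(_ isT isT tt' u0S).
      by rewrite leqNgt (leq_ltn_trans t'i iu0).
    move=> t t' tP t'P e; apply: ord_inj; apply/eqP.
    by rewrite eqn_leq (leqNgt t t') (leqNgt t' t) (aux _ _ t'P tP (esym e))
      (aux _ _ tP t'P e).
  have PE : f @: P = E.
    apply/eqP; rewrite eqEcard; apply/andP; split.
      apply/fintype.subsetP => _ /imsetP[t + ->].
      rewrite !inE => /andP[tS ti]; case ft : (f t) => [j|//] /=.
      have [jS tj] := fpar _ _ tS ft.
      apply/imsetP; exists j => //; rewrite inE jS /=.
      apply: leq_trans ti; rewrite -outer_ltE.
      exact: le_lt_trans tj (hole_lt_outer j).
    rewrite card_in_imset // cardsU1 card_imset; last by move=> ? ? [].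
    rewrite (_ : (None \notin _) = true); last first.
      by apply/imsetP => -[].
    rewrite (cardsD1 i P) inE iS leqnn leq_add2l leq_eqVlt.
    apply/orP; left; apply/eqP; apply: eq_card => t; rewrite !inE.
    by rewrite ltn_neqAle andbCA.
  have : p i \in f @: P.
    rewrite PE !inE; case pE : (p i) => [j|//] /=.
    have [ji jS] := parent_lt j pE.
    by apply/imsetP; exists j => //; rewrite inE jS.
  move=> /imsetP[t]; rewrite inE leq_eqVlt => /andP[tS /orP[/eqP/ord_inj ->|ti] e].
    by rewrite e eqxx in pfi.
  by have := nou t; rewrite chP tS -e eqxx ti.
have av : avail (p n).
  case pE : (p n) => [j|//] /=.
  have [jU nj] := ppar n j (finset.setU11 _ _) pE.
  move: jU; rewrite in_setU1 => /orP[/eqP jn|//].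
  by move: nj; rewrite jn leNgt hole_lt_outer.
apply: (no _ av); apply: packs_sub (ppk (p n)); apply/fintype.subsetP => i.
rewrite in_setU1 chP !inE => /orP[/eqP ->|/andP[iS /eqP fi]].
  by rewrite !eqxx.
by rewrite iS orbT (pf i.+1) // fi eqxx.
Qed.

(** * Greedy runs and the lex-max set *)

(** The scan never looks back: [i] is kept or not according to the members of
    the final set that precede it. *)
Lemma lexmaxE (R : realType) (I : instance R) (i : 'I_(nrings I)) :
  (i \in lexmax I) =
  `[< feasible (i |: [set j in lexmax I | (j < i)%N])%SET >].
Proof.
pose step (L : {set 'I_(nrings I)}) i :=
  if `[< feasible (i |: L)%SET >] then (i |: L)%SET else L.
pose F k := foldl step finset.set0 (take k (enum 'I_(nrings I))).
have FE m : (m <= nrings I)%N -> forall j : 'I_(nrings I),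
    (j \in F m) = (j < m)%N && `[< feasible (j |: F j)%SET >].
  elim: m => [_ j|m IH mN j]; first by rewrite /F take0 finset.in_set0.
  have -> : F m.+1 = step (F m) (Ordinal mN).
    rewrite /F (take_nth (Ordinal mN)) ?size_enum_ord // foldl_rcons.
    by rewrite (nth_ord_enum _ (Ordinal mN)).
  have {}IH := IH (ltnW mN) j.
  have [jm|jm] := eqVneq j (Ordinal mN).
    have jF : j \notin F m by rewrite IH jm ltnn.
    have jlt : (j < m.+1)%N by rewrite jm.
    have jmE : F m = F j by rewrite jm.
    rewrite -jm /step jlt -jmE.
    by case: ifP => _; [rewrite finset.setU11|rewrite (negbTE jF)].
  have -> : (j \in step (F m) (Ordinal mN)) = (j \in F m).
    by rewrite /step; case: ifP => // _; rewrite in_setU1 (negbTE jm).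
  have jmN : (j == m :> nat) = false.
    by apply: contraNF jm => /eqP jm; apply/eqP/val_inj.
  by rewrite IH [in RHS]ltnS [in RHS]leq_eqVlt jmN.
have lexE : lexmax I = F (nrings I).
  by rewrite /F take_oversize // size_enum_ord.
rewrite {1}lexE FE // ltn_ord /=; congr `[< feasible (_ |: _)%SET >].
apply/setP => j; rewrite inE lexE !FE ?ltn_ord //; last exact: ltnW.
by rewrite andbC.
Qed.

Definition parent_of (R : realType) (I : instance R) (e : decisions I)
    (i : 'I_(nrings I)) : container I := odflt None (e i).

Lemma parent_ofE (R : realType) (I : instance R) (e : decisions I)
    (i : 'I_(nrings I)) (c : container I) :
  (e i == Some c) = (i \in placed e) && (parent_of e i == c).
Proof. by rewrite inE /parent_of; case: (e i). Qed.

(** The contents of a container are packable because its last child was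
    admitted together with all the earlier ones. *)
Lemma greedy_placement (R : realType) (I : instance R) (e : decisions I)
    (m : nat) :
  greedy_execution e ->
  placement [set i in placed e | (i < m)%N]%SET (parent_of e).
Proof.
move=> ge; have r0 := @outer_gt0 R I.
have adm (i : 'I_(nrings I)) c : i \in placed e -> parent_of e i = c ->
    admits e i c.
  move=> ie /eqP pc; have /eqP eE : e i == Some c by rewrite parent_ofE ie.
  by have := ge i; rewrite eE.
split=> [i j|c].
  rewrite inE => /andP[ie im] pij.
  have [/= [ji ej] /(packableP _ _ r0) pk] := adm i _ ie pij.
  split; last by apply: packs_le pk; rewrite finset.setU11.
  by rewrite !inE (ltn_trans ji im) andbT; apply/eqP.
apply/packableP => //.
set C := [set i in _ | _]%SET.
have [->|[i0 i0C]] := set_0Vmem C.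
  by exists (fun=> (0, 0)); split=> [i|i j]; rewrite finset.in_set0.
case: (arg_maxnP (fun i : 'I_(nrings I) => i : nat) i0C) => k kC kmax.
have kE : (k \in placed e) /\ parent_of e k = c.
  have : k \in C by []; rewrite inE => /andP[+ /eqP].
  by rewrite inE => /andP[].
have [_ /(packableP _ _ r0)] := adm k c kE.1 kE.2.
apply: packs_sub; apply/fintype.subsetP => i iC; rewrite in_setU1.
have ik : (i <= k)%N := kmax i iC; have [//|ink] := eqVneq i k.
move: iC; rewrite inE /= => /andP[+ ic]; rewrite inE => /andP[ie _].
by rewrite inE parent_ofE ie ic andbT /= ltn_neqAle ik !andbT.
Qed.

Lemma greedy_lexmax (R : realType) (I : instance R) (e : decisions I) :
  rho I <= golden R -> greedy_execution e -> placed e = lexmax I.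
Proof.
move=> rI ge; apply/setP => i.
suff H m : forall i : 'I_(nrings I), (i < m)%N ->
    (i \in placed e) = (i \in lexmax I) by exact: (H i.+1).
elim: m => [//|m IH] {}i im; rewrite [in RHS]lexmaxE.
have -> : [set j in lexmax I | (j < i)%N]%SET =
    [set j in placed e | (j < i)%N]%SET.
  apply/setP => j; rewrite !inE; case ji: (j < i)%N; rewrite ?andbF ?andbT //.
  have := IH j (leq_trans ji im); rewrite inE => -> //.
set S := [set j in _ | _]%SET.
apply/idP/asboolP => [ie|[p pp]].
  exists (parent_of e).
  have -> : (i |: S)%SET = [set j in placed e | (j < i.+1)%N]%SET.
    apply/setP => j; rewrite in_setU1 !inE ltnS.
    have [->|ji] := eqVneq j i; first by move: ie; rewrite inE leqnn => ->.
    by rewrite ltn_neqAle (_ : (j != i :> nat) = true).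
  exact: greedy_placement.
apply: contrapT => /negP ie.
have eN : e i = None by move: ie; rewrite inE negbK => /eqP.
have Si j : j \in S -> (j < i)%N by rewrite inE => /andP[].
have [c [cS pk]] := placement_extends rI Si (greedy_placement i ge) pp.
have := ge i; rewrite eN => /(_ c); apply; split.
  case: c cS {pk} => [j|//] /=; rewrite !inE => /andP[ej ji].
  by split=> //; apply/eqP.
rewrite (_ : children_before e i c = children S (parent_of e) c) //.
apply/setP => j; rewrite !inE parent_ofE inE.
by rewrite andbA (andbC (j < i)%N).
Qed.

(** * Instances on which greedy fails *)

Lemma ord4P (P : 'I_4 -> Prop) :
  P (@Ordinal 4 0 isT) -> P (@Ordinal 4 1 isT) -> P (@Ordinal 4 2 isT) ->
  P (@Ordinal 4 3 isT) -> forall i, P i.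
Proof.
move=> P0 P1 P2 P3 [[|[|[|[|//]]]] h].
- by rewrite (_ : Ordinal h = @Ordinal 4 0 isT) //; apply: val_inj.
- by rewrite (_ : Ordinal h = @Ordinal 4 1 isT) //; apply: val_inj.
- by rewrite (_ : Ordinal h = @Ordinal 4 2 isT) //; apply: val_inj.
- by rewrite (_ : Ordinal h = @Ordinal 4 3 isT) //; apply: val_inj.
Qed.

(** The second radius is the inverse of the golden ratio. *)
Definition trap_outer (R : realType) (e : R) (i : 'I_4) : R :=
  nth 0 [:: 1; golden R - 1; 1 / 2 + 2 * e; 1 / 2 + e] i.

Definition trap_hole (R : realType) (e : R) (i : 'I_4) : R :=
  Num.max 0 (trap_outer e i - 1 / 5).

Lemma trap_holeE (R : realType) (e : R) (i : 'I_4) : 0 < e ->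
  trap_hole e i = trap_outer e i - 1 / 5.
Proof.
move=> e0; apply/max_idPr; have := golden_gt R.
by move: i; apply: ord4P; rewrite /trap_outer /=; lra.
Qed.

Lemma trap_outer_gt0 (R : realType) (e : R) (i : 'I_4) : 0 < e ->
  0 < trap_outer e i.
Proof.
by move=> e0; have := golden_gt R; move: i; apply: ord4P; rewrite /trap_outer /=; lra.
Qed.

Lemma trap_outer_decr (R : realType) (e : R) (i j : 'I_4) :
  0 < e -> e <= 1 / 100 -> (i < j)%N -> trap_outer e j < trap_outer e i.
Proof.
move=> e0 e1; have := golden_gt R; have := golden_lt R.
by move: i j; apply: ord4P; apply: ord4P => //=; rewrite /trap_outer /=; lra.
Qed.

Lemma trap_hole_lt (R : realType) (e : R) (i : 'I_4) : 0 < e ->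
  trap_hole e i < trap_outer e i.
Proof. by move=> e0; rewrite trap_holeE //; lra. Qed.

Lemma trap_hole_ge0 (R : realType) (e : R) (i : 'I_4) : 0 <= trap_hole e i.
Proof. by rewrite le_max lexx. Qed.

Lemma golden_gt0 (R : realType) : 0 < golden R.
Proof. by have := golden_gt R; lra. Qed.

Definition trap (R : realType) (e : R) (e0 : 0 < e) (e1 : e <= 1 / 100) :
    instance R :=
  @Instance R 4 (golden R) (trap_outer e) (trap_hole e) (golden_gt0 R)
    (fun i => trap_outer_gt0 i e0) (fun i j => @trap_outer_decr R e i j e0 e1)
    (trap_hole_ge0 e) (fun i => trap_hole_lt i e0).

Lemma trap_common_width (R : realType) (e : R) (e0 : 0 < e)
    (e1 : e <= 1 / 100) : common_width (trap e0 e1).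
Proof. by exists (1 / 5) => //; lra. Qed.

Lemma trap_rho (R : realType) (e : R) (e0 : 0 < e) (e1 : e <= 1 / 100) :
  rho (trap e0 e1) <= golden R + 6 * e.
Proof.
have f0 := golden_gt R; have f2 := golden_sqr R.
apply: bigmax_le => [|i _]; first by lra.
rewrite ler_pdivrMr; last exact: (@outer_gt0 R (trap e0 e1)).
rewrite big_mkcond /= !big_ord_recl big_ord0 /=.
by move: i; apply: ord4P; rewrite /trap_outer /=; nra.
Qed.

(** Rings 0 and 1 go to the pan, ring 2 to the hole of ring 0, ring 3 is
    skipped. *)
Definition trap_run (R : realType) (e : R) (e0 : 0 < e) (e1 : e <= 1 / 100) :
    decisions (trap e0 e1) :=
  fun i => nth None
    [:: Some None; Some None; Some (Some (@Ordinal 4 0 isT)); None] (i : 'I_4).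

Lemma trap_greedy (R : realType) (e : R) (e0 : 0 < e) (e1 : e <= 1 / 100) :
  greedy_execution (@trap_run R e e0 e1).
Proof.
have f0 := golden_gt R; have f1 := golden_lt R; have f2 := golden_sqr R.
have r0 : forall i, 0 < outer (trap e0 e1) i by exact: outer_gt0.
move=> i; move: (i : 'I_4); apply: ord4P => /=.
- split=> //; apply/(packableP _ _ r0).
  apply: (@packs_sub _ _ _ _ [set @Ordinal 4 0 isT]%SET).
    by apply/fintype.subsetP; apply: ord4P; rewrite !inE.
  by apply: packs1 => /=; rewrite /trap_outer /=; lra.
- split=> //; apply/(packableP _ _ r0).
  apply: (@packs_sub _ _ _ _ [set @Ordinal 4 0 isT; @Ordinal 4 1 isT]%SET).
    by apply/fintype.subsetP; apply: ord4P; rewrite !inE.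
  apply: (@packs_rows _ _ _ _ _
    [:: ([set @Ordinal 4 0 isT; @Ordinal 4 1 isT]%SET, (0, 0), golden R)]) => //.
    by move=> j jA /=; rewrite jA.
  rewrite /= andbT big_setU1 ?big_set1 ?inE //= edistxx /trap_outer /=.
  by apply/andP; split; lra.
- split=> //; apply/(packableP _ _ r0).
  apply: (@packs_sub _ _ _ _ [set @Ordinal 4 2 isT]%SET).
    by apply/fintype.subsetP; apply: ord4P; rewrite !inE.
  by apply: packs1 => /=; rewrite trap_holeE // /trap_outer /=; lra.
- move=> c [av /(packableP _ _ r0)] pk; move: c av pk => [|_].
    apply: ord4P => /=.
    + move=> _ pk.
      have := @packs_le2 _ _ _ _ _ (@Ordinal 4 2 isT) (@Ordinal 4 3 isT)
        _ _ _ pk.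
      rewrite !inE /= trap_holeE // /trap_outer /= => /(_ isT isT isT).
      by lra.
    + move=> _ /(@packs_le _ _ _ _ _ (@Ordinal 4 3 isT)).
      by rewrite !inE /= trap_holeE // /trap_outer /= => /(_ isT); lra.
    + move=> _ /(@packs_le _ _ _ _ _ (@Ordinal 4 3 isT)).
      by rewrite !inE /= trap_holeE // /trap_outer /= => /(_ isT); lra.
    + by case.
  move=> pk.
  have psi0 : 0 <= golden R - 1 by lra.
  (* The centers of rings 0 and 1 are opposite, and the weights 1 and
     [golden R - 1] balance them at the center of the pan; a small weight on
     ring 3 then detects that it is too large for the pocket. *)
  have := @packs_weights _ _ _ _ _ 1 (golden R - 1) e
    (@Ordinal 4 0 isT) (@Ordinal 4 1 isT) (@Ordinal 4 3 isT) pk.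
  rewrite !inE /= => /(_ isT isT isT isT isT isT r0 ler01 psi0 (ltW e0)).
  rewrite /trap_outer /=; apply/negP; rewrite -ltNge -subr_gt0.
  set x := (X in 0 < X).
  have -> : x = e ^+ 2 * (8 - (golden R - 1 / 2 - e) ^+ 2) +
      e * (4 * e - 2) * (golden R ^+ 2 - (golden R + 1)).
    by rewrite /x; field.
  rewrite f2 subrr mulr0 addr0.
  by rewrite mulr_gt0 ?exprn_gt0 //; nra.
Qed.

Lemma trap_fails (R : realType) (e : R) (e0 : 0 < e) (e1 : e <= 1 / 100) :
  greedy_can_fail (trap e0 e1).
Proof.
exists (@trap_run R e e0 e1); first exact: trap_greedy.
have f0 := golden_gt R; have f1 := golden_lt R.
have r0 : forall i, 0 < outer (trap e0 e1) i by exact: outer_gt0.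
move=> eL; have := @lexmaxE _ (trap e0 e1) (@Ordinal 4 3 isT).
rewrite -eL inE /= => /esym/negbT/asboolPn; apply.
(* Ring 1 fits into the hole of ring 0, which leaves the pan to rings 0, 2
   and 3. *)
pose p (i : 'I_4) : container (trap e0 e1) :=
  if i == @Ordinal 4 1 isT then Some (@Ordinal 4 0 isT) else None.
exists p; split.
  by apply: ord4P => j _ //= [<-]; split; rewrite ?inE //=;
    rewrite trap_holeE // /trap_outer /=; lra.
move=> c; apply/packableP => //.
have small (A : {set 'I_4}) H : A \subset [set @Ordinal 4 1 isT]%SET ->
    golden R - 1 <= H -> packs (trap_outer e) A H.
  by move=> AS gH; apply: packs_sub AS _; apply: packs1.
case: c => [|].
  apply: ord4P.
  + apply: small; last by rewrite /= trap_holeE // /trap_outer /=; lra.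
    by apply/fintype.subsetP; apply: ord4P; rewrite !inE.
  + exists (fun=> (0, 0)).
    by split=> [|i j]; [apply: ord4P|move: i; apply: ord4P]; rewrite !inE.
  + exists (fun=> (0, 0)).
    by split=> [|i j]; [apply: ord4P|move: i; apply: ord4P]; rewrite !inE.
  + exists (fun=> (0, 0)).
    by split=> [|i j]; [apply: ord4P|move: i; apply: ord4P]; rewrite !inE.
apply: (@packs_rows _ _ _ _ _
  [:: ([set @Ordinal 4 0 isT]%SET, (1 - golden R, 0), 1);
      ([set @Ordinal 4 2 isT]%SET, (87 / 100, 55 / 100), 55 / 100);
      ([set @Ordinal 4 3 isT]%SET, (87 / 100, - (55 / 100)), 55 / 100)]) => //.
- by apply: ord4P; rewrite !inE /= ?inE.
- rewrite /= !big_set1 /trap_outer /=.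
  have inside (q : R * R) (r H : R) : r <= H ->
      q.1 ^+ 2 + q.2 ^+ 2 <= (H - r) ^+ 2 -> edist q (0, 0) + r <= H.
    move=> rH h; rewrite -lerBrDr edist_le ?subr_ge0 //.
    by rewrite /= !subr0.
  apply/and4P; split=> //; apply/andP; split; rewrite ?lexx //; try lra;
    apply: inside => /=; nra.
- rewrite /= !andbT -andbA; apply/and3P; split; rewrite le_edist /=; nra.
Qed.

Lemma tau_golden (R : realType) (C : set (instance R)) :
  @common_width R `<=` C ->
  tau C = golden R /\
  ~ (exists I : instance R, C I /\ greedy_can_fail I /\ rho I = tau C).
Proof.
move=> wC.
have above (I : instance R) : greedy_can_fail I -> golden R < rho I.
  move=> [e ge pl]; rewrite ltNge; apply/negP => le; apply: pl.
  exact: greedy_lexmax.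
have lb : lbound (failing_rhos C) (golden R).
  by move=> _ [I [_ fI] <-]; apply/ltW/above.
have trap_in (e : R) (e0 : 0 < e) (e1 : e <= 1 / 100) :
    failing_rhos C (rho (trap e0 e1)).
  exists (trap e0 e1) => //; split; last exact: trap_fails.
  exact/wC/trap_common_width.
have tauE : tau C = golden R.
  apply/eqP; rewrite eq_le; apply/andP; split; last first.
    apply: lb_le_inf lb.
    have d0 : 0 < 1 / 100 :> R by lra.
    by eexists; exact: (trap_in _ d0 (lexx _)).
  apply/ler_addgt0Pr => d d0.
  pose e := Num.min (1 / 100) (d / 6).
  have e0 : 0 < e by rewrite lt_min; apply/andP; split; lra.
  have e1 : e <= 1 / 100 by rewrite ge_min lexx.
  have ed : e <= d / 6 by rewrite ge_min lexx orbT.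
  apply: le_trans (ge_inf _ (trap_in _ e0 e1)) _; first by exists (golden R).
  by apply: le_trans (trap_rho e0 e1) _; lra.
split=> // -[I [_ [fI]]]; rewrite tauE => rI.
by have := above I fI; rewrite rI ltxx.
Qed.

Theorem corollary29 (R : realType) :
  (tau (@common_width R) = golden R /\
   ~ (exists I : instance R,
        common_width I /\ greedy_can_fail I /\
        rho I = tau (@common_width R))) /\
  (tau (@independent_widths R) = golden R /\
   ~ (exists I : instance R,
        independent_widths I /\ greedy_can_fail I /\
        rho I = tau (@independent_widths R))).
Proof. by split; apply: tau_golden. Qed.
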